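(* For every measure space $(M,\Sigma,\mu)$ and $p\in[1,\infty)$ such that $L_p(\mu)$ is infinite-dimensional, the real Banach space $L_p(\mu)$ is $(<\kappa)$-$\phi_p$-octahedral, where $\kappa$ is the density of $L_p(\mu)$.
   Context: $\phi_p(t)=(1+t^p)^{1/p}-1$ for $t\ge0$. $\mathrm{dens}(X)$, the density of $X$, is the smallest cardinality of a subset of $X$ whose linear span is dense in $X$ (so $\mathrm{dens}(Z)<\omega$ means $Z$ is finite-dimensional); $S_X$ is the unit sphere of $X$. For an infinite cardinal $\kappa$, a normed space $X$ is $(<\kappa)$-$\phi_p$-octahedral if for every $\varepsilon>0$ and every subspace $Z$ of $X$ with $\mathrm{dens}(Z)<\kappa$ there is $x\in S_X$ such that $\|z+\lambda x\|\ge(1-\varepsilon)(1+\phi_p(|\lambda|))$ for all $z\in S_Z$ and $\lambda\in\mathbb{R}$. *)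

(* Defs.v *)
From HB Require Import structures.
From mathcomp Require Import all_boot all_order all_algebra.
From mathcomp Require Import all_classical all_reals all_analysis.
From mathcomp Require Import measurable_realfun ess_sup_inf.

Set Implicit Arguments.
Unset Strict Implicit.
Unset Printing Implicit Defensive.

Import Order.TTheory GRing.Theory Num.Theory.
Import numFieldNormedType.Exports.

Local Open Scope classical_set_scope.
Local Open Scope ring_scope.
Local Open Scope card_scope.

(* [LspaceType mu p1] is the library's type of classes, modulo equality
   mu-almost everywhere, of measurable functions with finite p-norm. The library
   gives it neither operations nor a norm: these are transported here from
   [LfunType mu p1] through representatives, the norm of f being 'N[mu]_p[f]. *)
Section Lspace_normed.
Local Open Scope quotient_scope.
Context d (T : measurableType d) (R : realType).
Variables (mu : {measure set T -> \bar R}) (p : \bar R) (p1 : (1 <= p)%E).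

Local Notation L := (LspaceType mu p1).
Local Notation F := (LfunType mu p1).

Lemma ae_eq_Lnorm (f g : T -> R) : f = g %[ae mu] ->
  measurable_fun [set: T] f -> measurable_fun [set: T] g ->
  ('N[mu]_p[EFin \o f] = 'N[mu]_p[EFin \o g])%E.
Proof.
move=> fg mf mg; rewrite unlock; case: p p1 => [r r1||//].
- have mpow (h : T -> R) : measurable_fun [set: T] h ->
      measurable_fun [set: T] (EFin \o (fun x => `|h x| `^ r) : T -> \bar R).
    move=> mh; apply/measurable_EFinP.
    apply: (@measurableT_comp _ _ _ _ _ _ (@powR R ^~ r)) => //.
    exact: measurableT_comp.
  congr (_ `^ _)%E; apply: ae_eq_integral => //.
  + exact: mpow.
  + exact: mpow.
  + by apply: filterS fg => x /[apply] /= ->.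
- move=> _ /=; case: ifPn => // _; apply: eq_ess_sup.
  by apply: filterS fg => x /(_ I) /= ->.
Qed.

Lemma Lspace_Lfun (f : L) : (f : T -> R) \in Lfun mu p.
Proof.
apply/andP; rewrite !inE; split; last exact: Lebesgue_finite.
have h := @measurable_funPT _ _ T (measurableTypeR R)
  (repr (LebesgueSpace.sort f)).
exact: h.
Qed.

Definition Lspace_repr (f : L) : F := Lfun_Sub p1 (Lspace_Lfun f).

Lemma Lfun_measurableTypeR (f : F) :
  measurable_fun [set: T] (f : T -> measurableTypeR R).
Proof. exact: (@measurable_funPT _ _ T R f). Qed.

Definition Lfun_mfun (f : F) : {mfun T >-> measurableTypeR R} :=
  HB.pack (f : T -> measurableTypeR R)
    (isMeasurableFun.Build _ _ T (measurableTypeR R) f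
      (@Lfun_measurableTypeR f)).

Definition Lfun_class (f : F) : {mfun_ mu, T >-> measurableTypeR R} :=
  \pi_{mfun_ mu, T >-> measurableTypeR R} (Lfun_mfun f).

Lemma Lfun_classE (f : F) : (Lfun_class f : T -> R) = f %[ae mu].
Proof.
have : repr (Lfun_class f) = Lfun_mfun f
  %[mod {mfun_ mu, T >-> measurableTypeR R}] by rewrite reprK.
by move/eqquotP/asboolP.
Qed.

Lemma Lfun_class_finite (f : F) : finite_norm mu p (Lfun_class f).
Proof.
rewrite /finite_norm (ae_eq_Lnorm (Lfun_classE f)).
- exact: Lfunction_finite.
- have h := @measurable_funPT _ _ T (measurableTypeR R) (repr (Lfun_class f)).
  exact: h.
- exact: measurable_funPT.
Qed.

Definition Lspace_pi (f : F) : L :=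
  HB.pack (Lfun_class f) (isFinLebesgue.Build _ T R mu p p1 (Lfun_class f)
    (Lfun_class_finite f)).

Lemma Lspace_piK (f : F) : (Lspace_repr (Lspace_pi f) : T -> R) = f %[ae mu].
Proof. exact: Lfun_classE. Qed.

Lemma Lspace_ext (f g : L) :
  (Lspace_repr f : T -> R) = Lspace_repr g %[ae mu] -> f = g.
Proof.
case: f g => [f [[hf]]] [g [[hg]]] /= fg.
have e : f = g by have := introT (ae_eqP f g) fg; rewrite !reprK => /eqP.
by case: _ / e hg fg => hg _; rewrite (Prop_irrelevance hf hg).
Qed.

Lemma Lspace_eqP (f g : F) :
  Lspace_pi f = Lspace_pi g <-> (f : T -> R) = g %[ae mu].
Proof.
split=> [fg|fg].
- apply: ae_eq_trans (Lspace_piK g); rewrite -fg.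
  exact/ae_eq_sym/Lspace_piK.
- apply: Lspace_ext; apply: ae_eq_trans (Lspace_piK f) _.
  exact: ae_eq_trans fg (ae_eq_sym (Lspace_piK g)).
Qed.

Lemma Lspace_reprK : cancel Lspace_repr Lspace_pi.
Proof. by move=> f; apply: Lspace_ext; exact: Lspace_piK. Qed.

Definition Lspace_add (f g : L) := Lspace_pi (Lspace_repr f + Lspace_repr g).
Definition Lspace_opp (f : L) := Lspace_pi (- Lspace_repr f).
Definition Lspace_scale (a : R) (f : L) := Lspace_pi (a *: Lspace_repr f).
Definition Lspace_norm (f : L) : R := fine 'N[mu]_p[EFin \o f]%E.

Lemma Lspace_piD f g : Lspace_add (Lspace_pi f) (Lspace_pi g) = Lspace_pi (f + g).
Proof.
apply/Lspace_eqP; move: (Lspace_piK f) (Lspace_piK g).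
apply: filterS2 => x ef eg xT; exact: (congr2 +%R (ef xT) (eg xT)).
Qed.

Lemma Lspace_piN f : Lspace_opp (Lspace_pi f) = Lspace_pi (- f).
Proof.
apply/Lspace_eqP; move: (Lspace_piK f).
apply: filterS => x ef xT; exact: (congr1 -%R (ef xT)).
Qed.

Lemma Lspace_piZ a f : Lspace_scale a (Lspace_pi f) = Lspace_pi (a *: f).
Proof.
apply/Lspace_eqP; move: (Lspace_piK f).
apply: filterS => x ef xT; exact: (congr1 ( *%R a) (ef xT)).
Qed.

Lemma Lspace_pi_norm f : Lspace_norm (Lspace_pi f) = fine 'N[mu]_p[EFin \o f]%E.
Proof.
congr fine; apply: ae_eq_Lnorm; first exact: Lspace_piK.
- exact: (@measurable_funPT _ _ T R (Lspace_repr (Lspace_pi f))).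
- exact: measurable_funPT.
Qed.

Lemma Lspace_ind (P : L -> Prop) : (forall f, P (Lspace_pi f)) -> forall f, P f.
Proof. by move=> h f; rewrite -[f]Lspace_reprK. Qed.

Lemma Lspace_addA : associative Lspace_add.
Proof.
elim/Lspace_ind => f; elim/Lspace_ind => g; elim/Lspace_ind => h.
by rewrite !Lspace_piD addrA.
Qed.

Lemma Lspace_addC : commutative Lspace_add.
Proof.
by elim/Lspace_ind => f; elim/Lspace_ind => g; rewrite !Lspace_piD addrC.
Qed.

Lemma Lspace_add0 : left_id (Lspace_pi 0) Lspace_add.
Proof. by elim/Lspace_ind => f; rewrite Lspace_piD add0r. Qed.

Lemma Lspace_addN : left_inverse (Lspace_pi 0) Lspace_opp Lspace_add.
Proof. by elim/Lspace_ind => f; rewrite Lspace_piN Lspace_piD addNr. Qed.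

HB.instance Definition _ := gen_eqMixin L.
HB.instance Definition _ := gen_choiceMixin L.
HB.instance Definition _ := GRing.isZmodule.Build L
  Lspace_addA Lspace_addC Lspace_add0 Lspace_addN.

Lemma Lspace_scaleA a b f :
  Lspace_scale a (Lspace_scale b f) = Lspace_scale (a * b) f.
Proof. by elim/Lspace_ind: f => f; rewrite !Lspace_piZ scalerA. Qed.

Lemma Lspace_scale1 : left_id 1 Lspace_scale.
Proof. by elim/Lspace_ind => f; rewrite Lspace_piZ scale1r. Qed.

Lemma Lspace_scaleDr : right_distributive Lspace_scale +%R.
Proof.
move=> a; elim/Lspace_ind => f; elim/Lspace_ind => g.
rewrite /GRing.add/= -/(Lspace_add _ _) Lspace_piD !Lspace_piZ.
by rewrite -[RHS]/(Lspace_add _ _) Lspace_piD scalerDr.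
Qed.

Lemma Lspace_scaleDl f : {morph Lspace_scale^~ f : a b / a + b}.
Proof.
move=> a b; elim/Lspace_ind: f => f.
by rewrite !Lspace_piZ -[RHS]/(Lspace_add _ _) Lspace_piD scalerDl.
Qed.

HB.instance Definition _ := GRing.Zmodule_isLmodule.Build R L
  Lspace_scaleA Lspace_scale1 Lspace_scaleDr Lspace_scaleDl.

Lemma Lspace_normD f g : Lspace_norm (f + g) <= Lspace_norm f + Lspace_norm g.
Proof.
elim/Lspace_ind: f => f; elim/Lspace_ind: g => g.
rewrite -[X in Lspace_norm X]/(Lspace_add _ _) Lspace_piD !Lspace_pi_norm.
exact: ler_LnormD.
Qed.

Lemma Lspace_normZ a f : Lspace_norm (a *: f) = `|a| * Lspace_norm f.
Proof.
elim/Lspace_ind: f => f.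
rewrite -[X in Lspace_norm X]/(Lspace_scale _ _) Lspace_piZ !Lspace_pi_norm.
by apply/EFin_inj; rewrite EFinM !finite_norm_fine LnormZ.
Qed.

Lemma Lspace_norm0_eq0 f : Lspace_norm f = 0 -> f = 0.
Proof.
elim/Lspace_ind: f => f; rewrite Lspace_pi_norm => /fine_Lnormr_eq0 f0.
exact/Lspace_eqP.
Qed.

HB.instance Definition _ := Lmodule_isNormed.Build R L
  Lspace_normD Lspace_normZ Lspace_norm0_eq0.

Lemma Lspace_normE (f : L) : `|f| = fine 'N[mu]_p[EFin \o f]%E.
Proof. by []. Qed.

End Lspace_normed.

(* Cardinals are represented by sets, compared with the library's [#<=]. *)
Definition card_lt T U (A : set T) (B : set U) := (A #<= B) && ~~ (B #<= A).

(* Any two cardinals being comparable, a nonempty family of sets has a member of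
   smallest cardinality: take a maximal set of choice functions on the family
   whose evaluation maps are all injective; one of these maps is surjective. *)
Lemma card_le_min T (F : set (set T)) : F !=set0 ->
  exists2 A, F A & forall B, F B -> A #<= B.
Proof.
move=> [A0 FA0].
pose P := [set S : set (set T -> T) |
  (forall g, S g -> forall A, F A -> A (g A)) /\
  (forall g h A, S g -> S h -> F A -> g A = h A -> g = h)].
have [|S [[PS1 PS2] Smax]] := @Zorn_bigcup _ P.
  move=> G GP Gtot; split=> [g [S GS Sg]|g h A [S GS Sg] [S' GS' Sh]].
    exact: (GP _ GS).1.
  by case: (Gtot _ _ GS GS') => SS'; [apply: (GP _ GS').2 => //; exact: SS'|
    apply: (GP _ GS).2 => //; exact: SS'].
have [A FA AS] : exists2 A, F A & A `<=` [set g A | g in S].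
  apply: contrapT => noA.
  have [t0 _] : exists t : T, True.
    apply: contrapT => noT; apply: noA; exists A0 => // x _.
    by case: noT; exists x.
  have /choice[g gP] A : exists x, F A -> A x /\ ~ [set g A | g in S] x.
    have [FA|nFA] := pselect (F A); last by exists t0.
    apply: contrapT => nx; apply: noA; exists A => // x Ax.
    by apply: contrapT => nS; apply: nx; exists x.
  have nSg : ~ S g by move=> Sg; case: (gP _ FA0) => _; apply; exists g.
  apply: (Smax (S `|` [set g])).
    split=> [h Sh|SgS]; first by left.
    by apply: nSg; exact: (SgS g (or_intror erefl)).
  split=> [h [Sh|->] A FA|h k A]; [exact: PS1 _ Sh _ FA|exact: (gP _ FA).1|].
  move=> [Sh|->] [Sk|->] FA // e; first exact: (PS2 _ _ _ Sh Sk FA e).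
  - by case: (gP _ FA) => _ []; exists h.
  - by case: (gP _ FA) => _ []; exists k.
exists A => // B FB.
have /choice[k kP] a : exists g, A a -> S g /\ g A = a.
  have [Aa|nAa] := pselect (A a); last by exists (fun=> a).
  by have [g Sg ga] := AS _ Aa; exists g.
have kinj : {in A &, injective (fun a => k a B)}.
  move=> a b /set_mem Aa /set_mem Ab e.
  have [[Sa ea] [Sb eb]] := (kP _ Aa, kP _ Ab).
  by rewrite -ea -eb (PS2 _ _ _ Sa Sb FB e).
rewrite -(card_le_eql (inj_card_eq kinj)).
by apply: subset_card_le => _ [a Aa <-]; exact: (PS1 _ (kP _ Aa).1 _ FB).
Qed.

Section density.
Context (R : realType) (X : normedModType R).

Definition linear_subspace : set (set X) :=
  [set Z | GRing.submod_closed (mem Z)].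

Definition linear_span (A : set X) : set X := smallest linear_subspace A.

Definition infinite_dimensional :=
  forall A : set X, finite_set A -> linear_span A <> [set: X].

Definition densely_spans (Z A : set X) :=
  A `<=` Z /\ Z `<=` closure (linear_span A).

Lemma dens_exists (Z : set X) : exists A, densely_spans Z A /\
  forall B, densely_spans Z B -> A #<= B.
Proof.
have [|A ZA Amin] := @card_le_min _ (densely_spans Z); last by exists A.
by exists Z; split=> //; apply: subset_trans (@subset_closure _ _);
  exact: sub_gen_smallest.
Qed.

(* The density of Z, as a set of the smallest cardinality. *)
Definition dens (Z : set X) : set X := sval (cid (dens_exists Z)).

Lemma densP (Z : set X) : densely_spans Z (dens Z) /\
  forall B, densely_spans Z B -> dens Z #<= B.
Proof. exact: svalP (cid (dens_exists Z)). Qed.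

End density.

Definition phi (R : realType) (p t : R) : R := (1 + t `^ p) `^ p^-1 - 1.

(* X is (< kappa)-f-octahedral, where kappa is the cardinality of K *)
Definition octahedral (R : realType) (U : Type) (K : set U) (f : R -> R)
    (X : normedModType R) :=
  forall (eps : R) (Z : set X), 0 < eps ->
    linear_subspace Z -> card_lt (dens Z) K ->
  exists x : X, `|x| = 1 /\
    forall (z : X) (lambda : R), Z z -> `|z| = 1 ->
      (1 - eps) * (1 + f `|lambda|) <= `|z + lambda *: x|.

(* Main.v *)
Require Import Defs.
From HB Require Import structures.
From mathcomp Require Import all_boot all_order all_algebra.
From mathcomp Require Import all_classical all_reals all_analysis.
From mathcomp Require Import measurable_realfun ess_sup_inf.

(** Fix a subspace [Z] of density smaller than that of [L_p(mu)]. It is enough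
    to find, for each [eta > 0], a set [B] of positive finite measure on which
    [Z] is small: [`|restr B z| <= eta * `|z|] for all [z] in [Z]. The
    normalized indicator [x] of [B] is then almost disjoint from [Z], and for
    disjoint functions [p]-th powers of norms add up, so that [`|z + l *: x|]
    is almost [(1 + `|l| ^ p) ^ (1 / p)] when [`|z| = 1]
    ([small_restr_octahedral]).

    If [Z] is finite-dimensional, any infinite sequence of disjoint sets of
    positive finite measure contains such a [B]: the norm of the restriction to
    the [k]-th set tends to [0] at each [z], hence uniformly on the unit sphere
    of [Z] ([finite_span_small]). There is such a sequence since otherwise the
    measure would be made of finitely many atoms, on which functions are
    constant, and [L_p(mu)] would be finite-dimensional
    ([infinite_disjoint_nonnull]).

    If the density of [Z] is infinite, let [D] be a subset of [Z] of that
    cardinality whose span is dense in [Z], and let [<<s G>>] be the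
    sigma-algebra generated by the sets [{z > q}] with [z] in [D] and [q]
    rational, [G] being the family of their finite intersections. Call a set
    [B] a relative atom if [<<s G>>] cuts out of [B] all of its measurable
    subsets, up to null sets. A set [B] that is not a relative atom has a
    nonnull subset [B'] with [mu (B' & F) <= mu (B & F) / 2] for all [F] in
    [<<s G>>], by the Hahn decomposition of a charge on [<<s G>>]
    ([exists_half]). Hence if some set [A] of positive finite measure contains
    no nonnull relative atom, it has, after [k] steps, a nonnull subset on
    which the integral of [`|z| ^ p] is at most [2 ^ - k] times its integral
    over [A], for all [<<s G>>]-measurable [z], and so for all [z] in [Z]
    ([no_relative_atom_small]). Also, if some set of positive finite measure is
    almost disjoint from the supports of all elements of [D], all of [Z]
    vanishes on it ([level_miss_small]).

    If neither happens, each set [{`|z| > 1 / (n + 1)}] with [z] in [D] is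
    covered by countably many relative atoms, and each set of finite measure is
    covered by countably many of these, up to null sets ([exhaustion]). By the
    pi-lambda theorem and dominated convergence, the indicators of the
    intersections of these relative atoms with the members of [G] span a dense
    subspace of [L_p(mu)]. They are indexed by elements of [D], natural numbers
    and finite sequences of such elements and rationals, and there are no more
    of these than elements of [D] because an infinite set [D] is equipotent to
    its square ([infinite_pairing]). So the density of [L_p(mu)] is at most
    that of [Z], a contradiction ([infinite_density_small]). *)

Set Implicit Arguments.
Unset Strict Implicit.
Unset Printing Implicit Defensive.

Import Order.TTheory GRing.Theory Num.Theory.
Import numFieldNormedType.Exports.

Local Open Scope classical_set_scope.
Local Open Scope ring_scope.

(** * Powers of an infinite cardinal *)

Lemma infinite_nat_inj T : infinite_set [set: T] ->
  exists g : nat -> T, injective g.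
Proof.
elim/Ppointed: T => T Tinf; first by rewrite empty_eq0 in Tinf.
have /infiniteP/pcard_injP[g ginj] := Tinf.
by exists g => m n; apply: ginj; rewrite inE.
Qed.

Lemma card_le_inj T U (A : set T) (B : set U) (u : U) : (A #<= B)%card ->
  exists2 h : T -> U, set_fun A B h & set_inj A h.
Proof.
elim/Ppointed: U => U in B u *; first by case: (no u).
by move=> /pcard_leP/injfunPex.
Qed.

Section square.
Variable T : Type.

(* [t.2] maps [t.1 * t.1] injectively into [t.1]; the two distinct points serve
   as tags when a second copy of [t.1] is adjoined. *)
Let closed_pairing (t : set T * (T * T -> T)) :=
  [/\ exists a b, [/\ t.1 a, t.1 b & a <> b],
      forall x y, t.1 x -> t.1 y -> t.1 (t.2 (x, y)) &
      forall x y x' y', t.1 x -> t.1 y -> t.1 x' -> t.1 y' ->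
        t.2 (x, y) = t.2 (x', y') -> (x, y) = (x', y')].

Let ext (s t : {t | closed_pairing t}) :=
  `[< (sval s).1 `<=` (sval t).1 /\ forall x y, (sval s).1 x -> (sval s).1 y ->
      (sval s).2 (x, y) = (sval t).2 (x, y) >].

Let ext_refl s : ext s s. Proof. by apply/asboolP; split. Qed.

Let ext_trans r s t : ext r s -> ext s t -> ext r t.
Proof.
move=> /asboolP[rs ers] /asboolP[st est]; apply/asboolP; split.
  exact: subset_trans st.
by move=> x y rx ry; rewrite ers ?est//; exact: rs.
Qed.

Let ext_chain (A : set {t | closed_pairing t}) :
  A !=set0 -> total_on A ext -> exists t, forall s, A s -> ext s t.
Proof.
move=> [s0 As0] Atot.
pose B := \bigcup_(s in A) (sval s).1.
have common x y : B x -> B y -> exists s, [/\ A s, (sval s).1 x & (sval s).1 y].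
  move=> [s As sx] [t At ty].
  case: (Atot s t As At) => /asboolP[st _]; [exists t|exists s]; split=> //;
    exact: st.
have agree s t x y : A s -> A t -> (sval s).1 x -> (sval s).1 y ->
    (sval t).1 x -> (sval t).1 y -> (sval s).2 (x, y) = (sval t).2 (x, y).
  move=> As At sx sy tx ty.
  by case: (Atot s t As At) => /asboolP[_ e]; rewrite e.
have [f fP] : exists f : T * T -> T, forall x y s, A s -> (sval s).1 x ->
    (sval s).1 y -> f (x, y) = (sval s).2 (x, y).
  have /choice[f fP] (xy : T * T) : exists z, forall s, A s ->
      (sval s).1 xy.1 -> (sval s).1 xy.2 -> z = (sval s).2 xy.
    have [[s [As sx sy]]|n] := pselect (exists s,
        [/\ A s, (sval s).1 xy.1 & (sval s).1 xy.2]).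
      exists ((sval s).2 xy) => t At tx ty.
      by case: xy sx sy tx ty => x y /= *; exact: agree.
    by exists xy.1 => s As sx sy; case: n; exists s.
  by exists f => x y s; exact: (fP (x, y)).
have Bf : closed_pairing (B, f).
  split=> /=.
  - case: (svalP s0) => -[a [b [a0 b0 ab]]] _ _.
    by exists a, b; split=> //; exists s0.
  - move=> x y Bx By; have [s [As sx sy]] := common x y Bx By.
    rewrite (fP _ _ s)//; exists s => //.
    by case: (svalP s) => _ h _; exact: h.
  - move=> x y x' y' Bx By Bx' By'.
    have [s [As sx sy]] := common x y Bx By.
    have [t [At tx ty]] := common x' y' Bx' By'.
    rewrite (fP _ _ s)// (fP _ _ t)//.
    case: (Atot s t As At) => /asboolP[st e].
      rewrite e//; case: (svalP t) => _ _; apply; rewrite //; exact: st.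
    rewrite (e x' y')//; case: (svalP s) => _ _; apply; rewrite //; exact: st.
exists (exist _ (B, f) Bf) => s As; apply/asboolP; split=> /=.
  by move=> x sx; exists s.
by move=> x y sx sy; rewrite (fP _ _ s).
Qed.

(** Zorn's lemma on the sets [B] that carry an injection [B * B -> B]: if [B] is
    maximal, its complement does not have the cardinality of [B] or more, for
    else a copy of [B] in the complement could be added to [B]. Hence all of [T]
    injects into [B + B], so into [B * B], so into [B]. *)
Lemma infinite_pairing : infinite_set [set: T] ->
  exists f : T * T -> T, injective f.
Proof.
move=> Tinf; have [g ginj] := infinite_nat_inj Tinf.
have [f0 f0P] : exists f : T * T -> T,
    forall m n, f (g m, g n) = g (choice.pickle (m, n)).
  have /choice[h hP] x : exists n, (exists m, g m = x) -> g n = x.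
    by have [[n <-]|n] := pselect (exists m, g m = x); [exists n|exists 0%N].
  exists (fun xy => g (choice.pickle (h xy.1, h xy.2))) => m n /=.
  by congr (g (choice.pickle (_, _))); apply: ginj; apply: hP; eexists.
have t0P : closed_pairing (range g, f0).
  split=> /=.
  - by exists (g 0%N), (g 1%N); split; [exists 0%N|exists 1%N|move=> /ginj].
  - by move=> _ _ [m _ <-] [n _ <-]; rewrite f0P; exists (choice.pickle (m, n)).
  - move=> _ _ _ _ [m _ <-] [n _ <-] [m' _ <-] [n' _ <-]; rewrite !f0P => /ginj.
    by move=> /(pcan_inj choice.pickleK)[-> ->].
pose t0 : {t | closed_pairing t} := exist _ _ t0P.
have [|[[B f] Bf] /= tmax] := ZL_preorder t0 ext_refl ext_trans.
  move=> A Atot; have [A0|/set0P An] := eqVneq A set0.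
    by exists t0 => s; rewrite A0.
  exact: ext_chain.
have [/= [a [b [Ba Bb ab]]] fB finj] := Bf.
have [BC|CB] : (B #<= ~` B)%card \/ (~` B #<= B)%card.
  have [|E [->|->] Emin] := @card_le_min T [set B; ~` B].
  - by exists B; left.
  - by left; apply: Emin; right.
  - by right; apply: Emin; left.
- exfalso.
  have [h hC hinj] := card_le_inj a BC.
  pose B' := B `|` h @` B.
  have /choice[k kP] x : exists y, B' x -> B y /\ (~ B x -> h y = x) /\
      (B x -> y = x).
    have [Bx|nBx] := pselect (B x); first by exists x.
    have [[//|[y By yx]]|nB'] := pselect (B' x); first by exists y.
    by exists x => /nB'.
  (* A pair of points of [B'] is coded in [B] by telling, for each of them, in
     which copy of [B] it lies and which point of that copy it is; pairs that
     are not in [B * B] are then sent to the second copy. *)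
  pose c x := if pselect (B x) then a else b.
  have Bc x : B (c x) by rewrite /c; case: pselect.
  pose code xy := f (f (c xy.1, c xy.2), f (k xy.1, k xy.2)).
  have Bk x : B' x -> B (k x) by move=> /kP[].
  have ckinj x y : B' x -> B' y -> c x = c y -> k x = k y -> x = y.
    move=> /kP[_ [nx ex]] /kP[_ [ny ey]]; rewrite /c.
    case: pselect => Bx; case: pselect => By //.
    - by move=> _; rewrite ex// ey.
    - by move=> /esym.
    - by move=> _ e; rewrite -nx// -ny// e.
  have Bcode x y : B' x -> B' y -> B (code (x, y)).
    by move=> B'x B'y; apply: (fB) (fB _ _ _ _) (fB _ _ _ _) => //; exact: Bk.
  pose f' xy := if pselect (B xy.1 /\ B xy.2) then f xy else h (code xy).
  have B'f' : closed_pairing (B', f').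
    split=> /=.
    - by exists a, b; split=> //; left.
    - move=> x y B'x B'y; rewrite /f'; case: pselect => /= [[Bx By]|_].
        by left; exact: fB.
      by right; exists (code (x, y)) => //; exact: Bcode.
    - move=> x y x' y' B'x B'y B'x' B'y'; rewrite /f'.
      case: pselect => /= [[Bx By]|nxy]; case: pselect => /= [[Bx' By']|nx'y'].
      + exact: finj.
      + move=> e; have /= := hC _ (Bcode _ _ B'x' B'y'); rewrite -e.
        by case; exact: fB.
      + move=> e; have /= := hC _ (Bcode _ _ B'x B'y); rewrite e.
        by case; exact: fB.
      + move=> /hinj; rewrite !inE => /(_ (Bcode _ _ B'x B'y)).
        move=> /(_ (Bcode _ _ B'x' B'y')) e.
        have [ce ke] := finj _ _ _ _ (fB _ _ (Bc _) (Bc _))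
          (fB _ _ (Bk _ B'x) (Bk _ B'y)) (fB _ _ (Bc _) (Bc _))
          (fB _ _ (Bk _ B'x') (Bk _ B'y')) e.
        have [cx cy] := finj _ _ _ _ (Bc _) (Bc _) (Bc _) (Bc _) ce.
        have [kx ky] := finj _ _ _ _ (Bk _ B'x) (Bk _ B'y) (Bk _ B'x')
          (Bk _ B'y') ke.
        by congr (_, _); exact: ckinj.
  have /(tmax (exist _ _ B'f'))/asboolP[/= B'B _] :
      ext (exist _ _ Bf) (exist _ _ B'f').
    apply/asboolP; split=> /= [x Bx|x y Bx By]; first by left.
    by rewrite /f'; case: pselect => // -[].
  have : B (h a) by apply: B'B; right; exists a.
  exact: (hC _ Ba).
- have [h hB hinj] := card_le_inj a CB.
  pose e x := if pselect (B x) then f (a, x) else f (b, h x).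
  have Be x : B (e x).
    by rewrite /e; case: pselect => ?; apply: (fB) => //; exact: hB.
  have einj : injective e.
    move=> x y; rewrite /e; case: pselect => Bx; case: pselect => By.
    - by move=> exy; have [] := finj _ _ _ _ Ba Bx Ba By exy.
    - by move=> exy; have [] := finj _ _ _ _ Ba Bx Bb (hB _ By) exy.
    - move=> exy; have [ba _] := finj _ _ _ _ Bb (hB _ Bx) Ba By exy.
      by case: ab.
    - move=> exy; have [] := finj _ _ _ _ Bb (hB _ Bx) Bb (hB _ By) exy.
      exact: (hinj _ _ (mem_set Bx) (mem_set By)).
  exists (fun xy => f (e xy.1, e xy.2)) => -[x y] [x' y'] /= exy.
  by have [/einj -> /einj ->] := finj _ _ _ _ (Be _) (Be _) (Be _) (Be _) exy.
Qed.

(** Iterated pairing codes the sequences of one length; the length is recorded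
    apart. *)
Lemma infinite_seq_inj : infinite_set [set: T] ->
  exists h : seq T -> T, injective h.
Proof.
move=> Tinf; have [g ginj] := infinite_nat_inj Tinf.
have [f finj] := infinite_pairing Tinf.
pose F s := foldr (fun x r => f (x, r)) (g 0%N) s.
exists (fun s => f (g (size s), F s)) => s t /finj[/ginj].
elim: s t => [|x s IH] [|y t]//= [st] /finj[-> e].
by rewrite (IH t).
Qed.

End square.

(** * Functions modulo null sets, and restriction to measurable sets *)

Lemma exponent_gt0 (R : realType) (p : R) : (1 <= p%:E)%E -> 0 < p.
Proof. by move=> p1; rewrite -lte_fin (lt_le_trans _ p1)// lte_fin. Qed.

Section Lspace_functions.
Context d (T : measurableType d) (R : realType).
Variables (mu : {measure set T -> \bar R}) (p : R) (p1 : (1 <= p%:E)%E).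

Local Notation L := (LspaceType mu p1).
Local Notation rep := (@Lspace_repr d T R mu p%:E p1).

Let p_gt0 := exponent_gt0 p1.

Definition pow_int (f : T -> R) := (\int[mu]_x (`|f x| `^ p)%:E)%E.

Lemma measurable_powR_norm (f : T -> R) : measurable_fun [set: T] f ->
  measurable_fun [set: T] (fun x => (`|f x| `^ p)%:E : \bar R).
Proof.
move=> mf; apply/measurable_EFinP.
apply: (@measurableT_comp _ _ _ _ _ _ (@powR R ^~ p)) => //.
exact: measurableT_comp.
Qed.

Lemma Lnorm_pow_int f : 'N[mu]_p%:E[EFin \o f]%E = (pow_int f `^ p^-1)%E.
Proof. by rewrite unlock. Qed.

Lemma pow_int_ge0 f : (0 <= pow_int f)%E.
Proof. by apply: integral_ge0 => x _; rewrite lee_fin powR_ge0. Qed.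

Lemma LfunE (f : T -> R) : f \in Lfun mu p%:E <->
  measurable_fun [set: T] f /\ (pow_int f < +oo)%E.
Proof.
split=> [/andP[]|[mf fy]].
  rewrite !inE /= => mf; rewrite /finite_norm Lnorm_pow_int => fy.
  split=> //; apply: (@lty_poweRy _ _ p^-1) => //.
  by rewrite invr_eq0 gt_eqF.
apply/andP; rewrite !inE; split=> //.
by rewrite /= /finite_norm Lnorm_pow_int poweR_lty.
Qed.

Lemma measurable_Lrepr (z : L) : measurable_fun [set: T] (rep z).
Proof. exact: (@measurable_funPT _ _ T R (rep z)). Qed.

Lemma Lrepr_Lfun (z : L) : (rep z : T -> R) \in Lfun mu p%:E.
Proof. exact: LfunP. Qed.

(** Total, with the default value [0] outside of [Lfun], so that classes can be
    written without carrying proofs of membership. *)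
Definition class (f : T -> R) : L :=
  if pselect (f \in Lfun mu p%:E) is left h
  then Lspace_pi (Lfun_Sub p1 h) else 0.

Lemma classK f : f \in Lfun mu p%:E -> rep (class f) = f %[ae mu].
Proof. by rewrite /class; case: pselect => // h _; exact: Lspace_piK. Qed.

Lemma class_Lrepr z : class (rep z) = z.
Proof.
by apply: Lspace_ext; apply: classK; exact: Lrepr_Lfun.
Qed.

Lemma eq_class f g : f \in Lfun mu p%:E -> g \in Lfun mu p%:E ->
  f = g %[ae mu] -> class f = class g.
Proof.
move=> fL gL fg; apply: Lspace_ext; apply: ae_eq_trans (classK fL) _.
exact: ae_eq_trans fg (ae_eq_sym (classK gL)).
Qed.

Lemma LreprD (y z : L) : rep (y + z) = (fun x => rep y x + rep z x) %[ae mu].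
Proof. exact: Lspace_piK. Qed.

Lemma LreprZ a (z : L) : rep (a *: z) = (fun x => a * rep z x) %[ae mu].
Proof. exact: Lspace_piK. Qed.

Lemma Lrepr0 : rep 0 = cst 0 %[ae mu].
Proof. exact: (@Lspace_piK _ _ _ mu p%:E p1 0). Qed.

Lemma Lfun0 : (cst 0 : T -> R) \in Lfun mu p%:E.
Proof. exact: (Lfun_submod_closed mu p1).1. Qed.

Lemma class0 : class (cst 0) = 0.
Proof.
rewrite -(class_Lrepr 0); apply: eq_class Lfun0 (Lrepr_Lfun 0) _.
exact/ae_eq_sym/Lrepr0.
Qed.

Lemma classD f g : f \in Lfun mu p%:E -> g \in Lfun mu p%:E ->
  class (fun x => f x + g x) = class f + class g.
Proof.
move=> fL gL; apply: Lspace_ext; apply: ae_eq_trans (classK _) _.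
  exact: (rpredD fL gL).
apply: ae_eq_sym; apply: ae_eq_trans (LreprD _ _) _.
apply: filterS2 (classK fL) (classK gL) => x ef eg xT.
by rewrite ef// eg.
Qed.

Lemma LfunZ a (f : T -> R) : f \in Lfun mu p%:E ->
  (fun x => a * f x) \in Lfun mu p%:E.
Proof.
move=> fL; rewrite -[f](Lfun_valP p1 fL).
exact: (LfunP (a *: Lfun_Sub p1 fL)).
Qed.

Lemma classZ a f : f \in Lfun mu p%:E ->
  class (fun x => a * f x) = a *: class f.
Proof.
move=> fL; apply: Lspace_ext; apply: ae_eq_trans (classK (LfunZ a fL)) _.
apply: ae_eq_sym; apply: ae_eq_trans (LreprZ _ _) _.
by apply: filterS (classK fL) => x ef xT; rewrite ef.
Qed.

Lemma eq_pow_int f g : measurable_fun [set: T] f -> measurable_fun [set: T] g ->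
  f = g %[ae mu] -> pow_int f = pow_int g.
Proof.
move=> mf mg fg; apply: ae_eq_integral => //; try exact: measurable_powR_norm.
by apply: filterS fg => x fg xT; rewrite fg.
Qed.

Lemma Lspace_norm_powR (z : L) : (`|z| `^ p)%:E = pow_int (rep z).
Proof.
have zf : (pow_int (rep z) < +oo)%E by have /LfunE[] := Lrepr_Lfun z.
have -> : `|z| = fine (pow_int (rep z) `^ p^-1)%E.
  rewrite -Lnorm_pow_int -{1}[z]Lspace_reprK.
  exact: Lspace_pi_norm.
rewrite -[pow_int _]fineK ?ge0_fin_numE ?pow_int_ge0// poweR_EFin /=.
by rewrite -powRrM mulVf ?gt_eqF// powRr1// fine_ge0// pow_int_ge0.
Qed.

Lemma class_norm_powR f : f \in Lfun mu p%:E ->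
  (`|class f| `^ p)%:E = pow_int f.
Proof.
move=> fL; rewrite Lspace_norm_powR; apply: eq_pow_int; last exact: classK.
- exact: measurable_Lrepr.
- by have /LfunE[] := fL.
Qed.

Lemma Lfun_le (f g : T -> R) : measurable_fun [set: T] f ->
  g \in Lfun mu p%:E -> (forall x, `|f x| <= `|g x|) -> f \in Lfun mu p%:E.
Proof.
move=> mf /LfunE[mg gy] fg; apply/LfunE; split; first exact: mf.
apply: (le_lt_trans _ gy); apply: ge0_le_integral => //.
- exact: measurable_powR_norm.
- exact: measurable_powR_norm.
- by move=> x _; rewrite lee_fin ge0_ler_powR// ?nnegrE// ltW.
Qed.

Definition restr (A : set T) (z : L) : L := class (fun x => \1_A x * rep z x).

Lemma Lfun_indicM A (f : T -> R) : measurable A -> f \in Lfun mu p%:E ->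
  (fun x => \1_A x * f x) \in Lfun mu p%:E.
Proof.
move=> mA fL; apply: Lfun_le (fL) _.
  by apply: measurable_funM => //; case/LfunE: fL.
move=> x; rewrite normrM indicE; case: (x \in A); last by rewrite normr0 mul0r.
by rewrite normr1 mul1r.
Qed.

Lemma restrE A z : measurable A ->
  rep (restr A z) = (fun x => \1_A x * rep z x) %[ae mu].
Proof.
by move=> mA; apply: classK; apply: Lfun_indicM => //; exact: Lrepr_Lfun.
Qed.

Lemma restrD A y z : measurable A -> restr A (y + z) = restr A y + restr A z.
Proof.
move=> mA; apply: Lspace_ext; apply: ae_eq_trans (restrE _ mA) _.
apply: ae_eq_sym; apply: ae_eq_trans (LreprD _ _) _.
move: (restrE y mA) (restrE z mA) (LreprD y z).
apply: filterS3 => x ey ez eyz xT.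
by rewrite ey// ez// eyz// mulrDr.
Qed.

Lemma restrZ A a z : measurable A -> restr A (a *: z) = a *: restr A z.
Proof.
move=> mA; apply: Lspace_ext; apply: ae_eq_trans (restrE _ mA) _.
apply: ae_eq_sym; apply: ae_eq_trans (LreprZ _ _) _.
move: (restrE z mA) (LreprZ a z).
by apply: filterS2 => x ez eaz xT; rewrite ez// eaz// mulrCA.
Qed.

Lemma restr_norm_powR A z : measurable A ->
  (`|restr A z| `^ p)%:E = (\int[mu]_(x in A) (`|rep z x| `^ p)%:E)%E.
Proof.
move=> mA; rewrite class_norm_powR; last first.
  by apply: Lfun_indicM => //; exact: Lrepr_Lfun.
rewrite [RHS]integral_mkcond; apply: eq_integral => x _.
rewrite /patch indicE; case: (x \in A); first by rewrite mul1r.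
by rewrite mul0r normr0 powR0// gt_eqF.
Qed.

Lemma restr_comp A B z : measurable A -> measurable B ->
  restr A (restr B z) = restr (A `&` B) z.
Proof.
move=> mA mB; apply: Lspace_ext; apply: ae_eq_trans (restrE _ mA) _.
have mAB := measurableI A B mA mB.
move: (restrE z mB) (restrE z mAB); apply: filterS2 => x eB eAB xT.
by rewrite eB// eAB// indicI/= mulrA.
Qed.

Lemma restr_setT z : restr [set: T] z = z.
Proof.
apply: Lspace_ext; apply: ae_eq_trans (restrE _ measurableT) _.
by apply: filterE => x xT; rewrite indicT mul1r.
Qed.

Lemma restr_norm_setU A B z : measurable A -> measurable B ->
  [disjoint A & B]%classic ->
  `|restr (A `|` B) z| `^ p = `|restr A z| `^ p + `|restr B z| `^ p.
Proof.
move=> mA mB AB; apply: EFin_inj; rewrite EFinD.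
rewrite (restr_norm_powR _ (measurableU _ _ mA mB)).
rewrite (restr_norm_powR _ mA) (restr_norm_powR _ mB) ge0_integral_setU//.
apply: measurable_funTS; apply: measurable_powR_norm; exact: measurable_Lrepr.
Qed.

Lemma powR_le_inv (a b : R) : 0 <= b -> a `^ p <= b `^ p -> a <= b.
Proof.
move=> b0; apply: contraTT; rewrite -!ltNge => ba.
by rewrite gt0_ltr_powR// nnegrE// ltW// (le_lt_trans b0).
Qed.

Lemma restr_norm_le A z : measurable A -> `|restr A z| <= `|z|.
Proof.
move=> mA; apply: powR_le_inv => //.
rewrite -[in leRHS](restr_setT z) -(setUv A) restr_norm_setU//.
- by rewrite lerDl powR_ge0.
- exact: measurableC.
- by apply/disj_setPS; rewrite setICr.
Qed.

End Lspace_functions.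

(** * Functions concentrated where a subspace is small *)

Section small_restriction.
Context d (T : measurableType d) (R : realType).
Variables (mu : {measure set T -> \bar R}) (p : R) (p1 : (1 <= p%:E)%E).

Local Notation L := (LspaceType mu p1).

Let p_gt0 := exponent_gt0 p1.

Definition finite_measurable (A : set T) := measurable A /\ (mu A < +oo)%E.

Definition nonnull (A : set T) := finite_measurable A /\ (0 < mu A)%E.

Definition ind (A : set T) : L := class mu p1 \1_A.

Lemma pow_int_indic (A : set T) : measurable A -> pow_int mu p \1_A = mu A.
Proof.
move=> mA; rewrite -[in RHS](setIT A) -(@integral_indic _ _ _ mu)//.
apply: eq_integral => x _; rewrite indicE; case: (x \in A).
  by rewrite normr1 powR1.
by rewrite normr0 powR0// gt_eqF.
Qed.

Lemma Lfun_indic (A : set T) : finite_measurable A -> \1_A \in Lfun mu p%:E.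
Proof.
by move=> [mA muA]; apply/LfunE => //; rewrite pow_int_indic//; split.
Qed.

Lemma ind_norm_powR (A : set T) : finite_measurable A ->
  (`|ind A| `^ p)%:E = mu A.
Proof.
by move=> fA; rewrite class_norm_powR ?Lfun_indic// pow_int_indic//; case: fA.
Qed.

Lemma finite_measurableI (A B : set T) : finite_measurable A -> measurable B ->
  finite_measurable (A `&` B).
Proof.
move=> [mA muA] mB; split; first exact: measurableI.
apply: le_lt_trans muA; apply: le_measure; rewrite ?inE//.
exact: measurableI.
Qed.

Lemma restr_ind (A B : set T) : finite_measurable A -> measurable B ->
  restr B (ind A) = ind (A `&` B).
Proof.
move=> fA mB; apply: Lspace_ext; apply: ae_eq_trans (restrE _ mB) _.
apply: ae_eq_sym; apply: ae_eq_trans (classK p1 (Lfun_indic _)) _.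
  exact: finite_measurableI.
apply: filterS (classK p1 (Lfun_indic fA)) => x eA xT.
by rewrite eA// indicI mulrC.
Qed.

Lemma ind0 (A : set T) : finite_measurable A -> mu A = 0%E -> ind A = 0.
Proof.
move=> fA A0; have := ind_norm_powR fA; rewrite A0 => -[/eqP].
by rewrite powR_eq0 => /andP[/eqP/normr0_eq0].
Qed.

Lemma restr_setC (B : set T) (z : L) : measurable B ->
  z = restr B z + restr (~` B) z.
Proof.
move=> mB; have mCB := measurableC mB.
apply: Lspace_ext; apply: ae_eq_sym; apply: ae_eq_trans (LreprD _ _) _.
move: (restrE z mB) (restrE z mCB); apply: filterS2 => x eB eCB xT.
rewrite eB// eCB// !indicE in_setC.
by case: (x \in B); rewrite /= !(mul1r, mul0r) ?addr0 ?add0r.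
Qed.

Lemma restr_norm_setC (B : set T) (z : L) : measurable B ->
  `|z| `^ p = `|restr B z| `^ p + `|restr (~` B) z| `^ p.
Proof.
move=> mB; rewrite -[in LHS](restr_setT z) -(setUv B) restr_norm_setU//.
- exact: measurableC.
- by apply/disj_setPS; rewrite setICr.
Qed.

(** Splitting [z] into its parts on and off [B], where [x] lives on [B], the
    part of [z] on [B] is an error of size [eta], and the part off [B], of norm
    at least [1 - eta], is disjoint from [x], so that [p]-th powers of norms
    add up. *)
Lemma disjoint_norm_lower (B : set T) (x z : L) (eta l : R) : measurable B ->
  restr B x = x -> `|x| = 1 -> `|z| = 1 -> `|restr B z| <= eta -> eta <= 1 ->
  (1 - eta *+ 2) * (1 + phi p `|l|) <= `|z + l *: x|.
Proof.
move=> mB Bx x1 z1 zeta eta1; have mCB := measurableC mB.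
have eta0 : 0 <= eta by exact: le_trans zeta.
set y := restr (~` B) z.
have zE : z = restr B z + y by exact: restr_setC.
have yge : 1 - eta <= `|y|.
  rewrite lerBlDr -z1 [X in `|X|]zE addrC.
  by rewrite (le_trans (ler_normD _ _))// lerD2l.
have CBx : restr (~` B) x = 0.
  by apply: (addrI x); rewrite addr0 -{1}Bx -restr_setC.
have ynorm : `|y + l *: x| `^ p = `|y| `^ p + `|l| `^ p.
  rewrite (restr_norm_setC _ mB) addrC !restrD// !restrZ// CBx Bx scaler0 addr0.
  rewrite /y restr_comp// setIid restr_comp// setICr.
  have -> : restr set0 z = 0.
    apply: normr0_eq0; apply/eqP; have := restr_norm_powR z (@measurable0 _ T).
    by rewrite integral_set0 => -[/eqP]; rewrite powR_eq0 => /andP[].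
  by rewrite add0r normrZ x1 mulr1.
have one q : (1 : R) `^ q = 1 by rewrite powR1.
have lower : (1 - eta) * (1 + phi p `|l|) <= `|y + l *: x|.
  apply: (powR_le_inv p1) => //.
  have phiE : 1 + phi p `|l| = (1 + `|l| `^ p) `^ p^-1.
    by rewrite /phi addrC subrK.
  rewrite ynorm phiE powRM ?subr_ge0 ?powR_ge0// -powRrM mulVf ?gt_eqF//.
  rewrite powRr1 ?addr_ge0 ?powR_ge0// mulrDr mulr1 lerD//.
    by rewrite ge0_ler_powR ?nnegrE ?subr_ge0// ltW.
  rewrite ler_piMl ?powR_ge0// -[leRHS](one p).
  by rewrite ge0_ler_powR ?nnegrE ?subr_ge0 ?gerBl// ltW.
have phi1 : 1 <= 1 + phi p `|l|.
  rewrite /phi addrC subrK -[leLHS](one p^-1).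
  rewrite ge0_ler_powR ?nnegrE ?invr_ge0 ?(ltW p_gt0)// ?addr_ge0 ?powR_ge0//.
  by rewrite lerDl powR_ge0.
have -> : z + l *: x = y + l *: x - (- restr B z).
  by rewrite opprK addrAC [y + _]addrC -zE.
apply: le_trans (lerB_dist _ _); rewrite normrN.
rewrite mulr2n opprD addrA mulrBl lerB//.
by rewrite (le_trans zeta)// ler_peMr.
Qed.

(** The normalized indicator of [B] is the witness, for an error that is at most
    [eps / 2] because [disjoint_norm_lower] loses it twice: once in the norm off
    [B], once in the triangle inequality. *)
Lemma small_restr_octahedral (Z : set L) (eps : R) : 0 < eps ->
  (forall eta : R, 0 < eta -> exists2 B, nonnull B &
     forall z, Z z -> `|restr B z| <= eta * `|z|) ->
  exists x : L, `|x| = 1 /\ forall (z : L) (l : R), Z z -> `|z| = 1 ->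
    (1 - eps) * (1 + phi p `|l|) <= `|z + l *: x|.
Proof.
move=> eps0 small; pose eta := Num.min (eps / 2) 1.
have [|B [[mB muB] B0] BZ] := small eta.
  by rewrite lt_min ltr01 divr_gt0.
have nB : `|ind B| != 0.
  apply/eqP => nB0; move: B0; rewrite -ind_norm_powR// nB0 powR0 ?gt_eqF//.
  by rewrite ltxx.
exists (`|ind B|^-1 *: ind B).
have x1 : `|(`|ind B|^-1 *: ind B : L)| = 1.
  by rewrite normrZ normfV normr_id mulVf.
split=> // z l Zz z1.
apply: (@le_trans _ _ ((1 - eta *+ 2) * (1 + phi p `|l|))).
  rewrite ler_wpM2r//; first by rewrite /phi addrC subrK powR_ge0.
  by rewrite lerD2l lerN2 -mulr_natr -ler_pdivlMr// ge_min lexx.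
apply: (@disjoint_norm_lower B) => //.
- by rewrite restrZ// restr_ind// setIid.
- by have := BZ _ Zz; rewrite z1 mulr1.
- by rewrite ge_min lexx orbT.
Qed.

End small_restriction.

(** * Closed subspaces and dominated convergence *)

Section normed_closure.
Context (R : realType) (X : normedModType R).
Implicit Types (V Z : set X) (x y z : X).

Lemma closure_normP V z :
  closure V z <-> forall e : R, 0 < e -> exists2 v, V v & `|z - v| < e.
Proof.
split=> [Vz e e0|h U /nbhs_ballP[e /= e0 eU]].
  have [|v [Vv]] := Vz (ball z e); first exact: nbhsx_ballx.
  by rewrite -ball_normE /= => zv; exists v.
have [v Vv zv] := h e e0.
by exists v; split=> //; apply: eU; rewrite -ball_normE.
Qed.

Lemma linear_subspaceP V : linear_subspace V <->
  V 0 /\ forall a x y, V x -> V y -> V (a *: x + y).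
Proof.
split=> [[V0 VZ]|[V0 VZ]]; split.
- by have := V0; rewrite inE.
- by move=> a x y Vx Vy; have := VZ a x y; rewrite !inE; exact.
- by rewrite inE.
- by move=> a x y; rewrite !inE; exact: VZ.
Qed.

Lemma linear_span_subspace V : linear_subspace (linear_span V).
Proof.
apply/linear_subspaceP; split=> [Z [/linear_subspaceP[Z0 _] _]//|].
move=> a x y Vx Vy Z [Zlin VZ]; have /linear_subspaceP[_] := Zlin.
by apply; [exact: Vx|exact: Vy].
Qed.

Lemma sub_linear_span V : V `<=` linear_span V.
Proof. exact: sub_gen_smallest. Qed.

Lemma linear_span_sub V Z :
  linear_subspace Z -> V `<=` Z -> linear_span V `<=` Z.
Proof. by move=> Zlin VZ; exact: smallest_sub. Qed.

Lemma closure_subspace V : linear_subspace V -> linear_subspace (closure V).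
Proof.
move=> /linear_subspaceP[V0 Vlin]; apply/linear_subspaceP; split.
  exact: subset_closure.
move=> a x y /closure_normP Vx /closure_normP Vy; apply/closure_normP => e e0.
have a0 : 0 < `|a| + 1 by rewrite ltr_wpDl.
have [|u Vu xu] := Vx (e / 2 / (`|a| + 1)); first by rewrite !divr_gt0.
have [|v Vv yv] := Vy (e / 2); first by rewrite divr_gt0.
exists (a *: u + v); first exact: Vlin.
have -> : a *: x + y - (a *: u + v) = a *: (x - u) + (y - v).
  by rewrite scalerBr opprD addrACA.
rewrite (le_lt_trans (ler_normD _ _))// [ltRHS]splitr ler_ltD// normrZ.
move: xu; rewrite ltr_pdivlMr// mulrC => /ltW; apply: le_trans.
by rewrite ler_wpM2r// lerDl.
Qed.

Lemma closure_id_norm V z : closure (closure V) z -> closure V z.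
Proof. by have /closure_id <- := @closed_closure _ V. Qed.

End normed_closure.

Section dominated.
Context d (T : measurableType d) (R : realType).
Variables (mu : {measure set T -> \bar R}) (p : R) (p1 : (1 <= p%:E)%E).

Local Notation L := (LspaceType mu p1).
Local Notation class := (class mu p1).

Let p_gt0 := exponent_gt0 p1.

(** Dominated convergence of [|f n - g| ^ p], with bound [(2 |h|) ^ p]. *)
Lemma dominated_class (f : nat -> T -> R) (g h : T -> R) :
  h \in Lfun mu p%:E -> (forall n, measurable_fun [set: T] (f n)) ->
  (forall x, f n x @[n --> \oo] --> g x) -> (forall n x, `|f n x| <= `|h x|) ->
  forall e : R, 0 < e -> \forall n \near \oo, `|class (f n) - class g| < e.
Proof.
move=> hL mf fg fh e e0.
have mg : measurable_fun [set: T] g.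
  by apply: (measurable_fun_cvg mf) => x _; exact: fg.
have gh x : `|g x| <= `|h x|.
  rewrite -(cvg_lim (@norm_hausdorff _ R) (cvg_norm (fg x))).
  apply: limr_le; last by apply: nearW.
  by apply/cvg_ex; eexists; exact: cvg_norm (fg x).
have fL n : f n \in Lfun mu p%:E by exact: (Lfun_le p1 (mf n) hL).
have gL : g \in Lfun mu p%:E by exact: (Lfun_le p1 mg hL).
pose u n x := f n x + - 1 * g x.
have ngL : (fun x => - 1 * g x) \in Lfun mu p%:E.
  by rewrite -[X in X \in _]/(fun x => - 1 * g x); exact: (LfunZ p1 _ gL).
have uE n : class (f n) - class g = class (u n).
  by rewrite classD// classZ// scaleN1r.
have uL n : u n \in Lfun mu p%:E by exact: (rpredD (fL n) ngL).
have /(LfunE mu p1)[mh hy] := hL.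
have mu' n : measurable_fun [set: T] (u n) by have /(LfunE mu p1)[] := uL n.
have cvg_u : pow_int mu p (u n) @[n --> \oo] --> 0%E.
  rewrite -(@integral0 _ _ _ mu setT).
  apply: (@dominated_cvg _ _ _ mu setT measurableT
    (fun n x => (`|u n x| `^ p)%:E) (cst 0%E)
    (fun x => (2 `^ p * `|h x| `^ p)%:E)).
  - by move=> n; exact: measurable_powR_norm.
  - move=> x _; apply/fine_cvgP; split; first by apply: nearW.
    apply/cvgrPdist_lt => e' e'0; have := fg x => /cvgrPdist_lt.
    move=> /(_ (e' `^ p^-1)); rewrite powR_gt0// => /(_ isT).
    apply: filterS => n /= gfn; rewrite sub0r normrN ger0_norm ?powR_ge0//.
    have -> : e' = (e' `^ p^-1) `^ p.
      by rewrite -powRrM mulVf ?gt_eqF// powRr1// ltW.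
    by rewrite gt0_ltr_powR// ?nnegrE ?powR_ge0// /u mulN1r distrC.
  - by [].
  - apply/integrableP; split.
      by apply/measurable_EFinP/measurable_funM => //; apply/measurable_EFinP;
        exact: measurable_powR_norm.
    under eq_integral do rewrite gee0_abs ?lee_fin ?mulr_ge0 ?powR_ge0// EFinM.
    rewrite ge0_integralZl_EFin ?powR_ge0//; last first.
      exact: measurable_powR_norm.
    by rewrite lte_mul_pinfty// lee_fin powR_ge0.
  - move=> n x _; rewrite gee0_abs ?lee_fin ?powR_ge0//.
    rewrite -powRM// ge0_ler_powR ?nnegrE ?mulr_ge0// ?(ltW p_gt0)//.
    rewrite /u mulN1r (le_trans (ler_normB _ _))// mulr_natl mulr2n lerD//.
have /fine_cvgP[_ /cvgrPdist_lt/(_ (e `^ p))] := cvg_u.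
rewrite powR_gt0// => /(_ isT); apply: filterS => n /=.
rewrite sub0r normrN uE -class_norm_powR// /= ger0_norm ?powR_ge0//.
apply: contraTT; rewrite -!leNgt => en.
by rewrite ge0_ler_powR ?nnegrE// ltW.
Qed.

End dominated.

(** * Finitely generated subspaces *)

Section finitely_generated.
Context d (T : measurableType d) (R : realType).
Variables (mu : {measure set T -> \bar R}) (p : R) (p1 : (1 <= p%:E)%E).

Local Notation L := (LspaceType mu p1).
Local Notation class := (class mu p1).
Local Notation ind := (ind mu p1).
Local Notation rep := (@Lspace_repr d T R mu p%:E p1).
Local Notation nonnull := (@nonnull _ T R mu).
Local Notation finite_measurable := (@finite_measurable _ T R mu).

Lemma restr_le_closure (B : set T) (V : set L) (eta : R) : measurable B ->
  0 <= eta -> (forall z, V z -> `|restr B z| <= eta * `|z|) ->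
  forall z, closure V z -> `|restr B z| <= eta * `|z|.
Proof.
move=> mB eta0 VB z /closure_normP Vz; apply/ler_addgt0Pr => e e0.
have eta1 : 0 < eta + 1 by rewrite ltr_wpDl.
have [|v Vv zv] := Vz (e / (eta + 1)); first by rewrite divr_gt0.
have {}zv : (eta + 1) * `|z - v| <= e by rewrite mulrC -ler_pdivlMr// ltW.
have -> : restr B z = restr B v + restr B (z - v).
  by rewrite -restrD// addrC subrK.
rewrite (le_trans (ler_normD _ _))//.
rewrite (le_trans (lerD (VB _ Vv) (restr_norm_le _ mB)))//.
apply: (@le_trans _ _ (eta * `|z| + (eta + 1) * `|z - v|)); last first.
  by rewrite lerD2l.
rewrite mulrDl mul1r addrA lerD2r -mulrDr ler_wpM2l//.
by rewrite -[X in `|X| <= _](subKr z) (le_trans (ler_normB _ _)).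
Qed.

Section eventually_small.
Variables (B : nat -> set T) (mB : forall k, measurable (B k)).
Hypothesis tB : trivIset [set: nat] B.

Let small (V : set L) := forall eta : R, 0 < eta ->
  \forall k \near \oo, forall z, V z -> `|restr (B k) z| <= eta * `|z|.

(** The indicators of the [B k] tend to [0] pointwise, by disjointness. *)
Lemma restr_trivIset_cvg0 (w : L) (e : R) : 0 < e ->
  \forall k \near \oo, `|restr (B k) w| < e.
Proof.
move=> e0.
suff : \forall k \near \oo, `|restr (B k) w - class (cst 0)| < e.
  by apply: filterS => k; rewrite class0 subr0.
apply: (@dominated_class _ _ _ mu p p1 (fun k x => \1_(B k) x * rep w x) (cst 0)
  (rep w) (Lrepr_Lfun w)) => // [k|x|k x].
- by apply: measurable_funM => //; exact: measurable_Lrepr.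
- have [[j _ Bjx]|nB] := pselect ((\bigcup_j B j) x).
    apply: cvg_near_cst; near=> k.
    rewrite indicE memNset ?mul0r// => Bkx.
    have jk : j = k by apply: tB => //; exists x.
    suff : (j < k)%N by rewrite jk ltnn.
    by near: k; exists j.+1.
  apply: cvg_near_cst; apply: nearW => k.
  by rewrite indicE memNset ?mul0r// => Bkx; apply: nB; exists k.
- rewrite normrM indicE; case: (x \in _); last by rewrite normr0 mul0r.
  by rewrite normr1 mul1r.
Unshelve. all: by end_near. Qed.

Let small_closure (V : set L) : small V -> small (closure V).
Proof.
move=> Vs eta eta0; apply: filterS (Vs eta eta0) => k Vk.
by apply: restr_le_closure => //; exact: ltW.
Qed.

Let small_add_line (V : set L) (w : L) : linear_subspace V -> small V ->
  exists W, [/\ linear_subspace W, V `<=` W, W w & small W].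
Proof.
move=> Vlin Vs; have /linear_subspaceP[V0 VZ] := Vlin.
have cVlin := closure_subspace Vlin.
have [Vw|nVw] := pselect (closure V w).
  exists (closure V); split=> //; first exact: subset_closure.
  exact: small_closure.
have [r r0 rV] : exists2 r : R, 0 < r & forall v, V v -> r <= `|w - v|.
  apply: contrapT => nr; apply: nVw; apply/closure_normP => e e0.
  apply: contrapT => nv; apply: nr; exists e => // v Vv.
  by rewrite leNgt; apply/negP => wv; apply: nv; exists v.
have rVa a v : V v -> r * `|a| <= `|v + a *: w|.
  have [->|a0] := eqVneq a 0; first by rewrite normr0 mulr0.
  move=> Vv; have -> : v + a *: w = a *: (w - (- a^-1 *: v)).
    by rewrite scaleNr opprK scalerDr scalerA mulfV// scale1r addrC.
  rewrite normrZ mulrC ler_wpM2l// rV// -[X in V X]addr0.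
  exact: VZ.
exists [set u | exists2 v, V v & exists a, u = v + a *: w]; split.
- apply/linear_subspaceP; split.
    by exists 0 => //; exists 0; rewrite scale0r addr0.
  move=> a _ _ [v Vv [b ->]] [v' Vv' [b' ->]].
  exists (a *: v + v'); first exact: VZ.
  exists (a * b + b'); rewrite scalerDr scalerDl scalerA.
  by rewrite -!addrA; congr (_ + _); rewrite addrCA.
- by move=> v Vv; exists v => //; exists 0; rewrite scale0r addr0.
- by exists 0 => //; exists 1; rewrite scale1r add0r.
- move=> eta eta0.
  (* [`|v| <= c * `|v + a *: w|], since [`|a| <= `|v + a *: w| / r]. *)
  pose c := 1 + `|w| / r; have c0 : 0 < c by rewrite ltr_pwDl// divr_ge0// ltW.
  have e10 : 0 < eta / 2 / c by rewrite !divr_gt0.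
  have e20 : 0 < eta / 2 * r by rewrite mulr_gt0// divr_gt0.
  apply: filterS2 (Vs _ e10) (restr_trivIset_cvg0 w e20) => k Vk wk.
  move=> _ [v Vv [a ->]]; set u := v + a *: w.
  have av : `|a| <= `|u| / r by rewrite ler_pdivlMr// mulrC; exact: rVa.
  have vu : `|v| <= c * `|u|.
    have -> : v = u - a *: w by rewrite addrK.
    rewrite (le_trans (ler_normB _ _))// mulrDl mul1r lerD2l normrZ.
    by rewrite mulrAC -mulrA [leRHS]mulrC ler_wpM2r.
  rewrite /u restrD// restrZ// (le_trans (ler_normD _ _))// -/u.
  rewrite [in leRHS](splitr eta) mulrDl lerD//.
    apply: le_trans (Vk _ Vv) _; rewrite -[leLHS]mulrA ler_wpM2l//.
      by rewrite divr_ge0// ltW.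
    by rewrite ler_pdivrMl.
  rewrite normrZ; apply: le_trans (ler_pM _ _ av (ltW wk)) _ => //.
  by rewrite mulrC -[leLHS]mulrA [r * _]mulrC divfK// gt_eqF.
Qed.

(** A finitely generated subspace is eventually small on disjoint sets [B k]:
    adjoin the generators one at a time, a generator [w] at positive distance
    from the subspace [V] built so far controlling the norm of its coefficient
    in [V + R w]. *)
Lemma finite_span_small (F : set L) (eta : R) : finite_set F -> 0 < eta ->
  \forall k \near \oo, forall z, closure (linear_span F) z ->
    `|restr (B k) z| <= eta * `|z|.
Proof.
move=> /finite_seqP[s ->] eta0.
suff [V [Vlin sV Vs]] : exists V,
    [/\ linear_subspace V, [set` s] `<=` V & small V].
  apply: filterS (small_closure Vs eta0) => k Vk z zF; apply: Vk.
  exact: (closure_subset (linear_span_sub Vlin sV) zF).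
elim: s => [|w s [V [Vlin sV Vs]]].
  exists [set 0]; split=> //.
    apply/linear_subspaceP; split=> // a _ _ -> ->.
    by rewrite scaler0 addr0.
  move=> e e0; apply: nearW => k _ ->.
  by rewrite (le_trans (restr_norm_le _ _))// normr0 mulr0.
have [W [Wlin VW Ww Ws]] := small_add_line w Vlin Vs.
exists W; split=> // z /=; rewrite inE => /orP[/eqP->//|zs].
exact/VW/sV.
Qed.

End eventually_small.
End finitely_generated.

(** * Infinitely many disjoint sets *)

Section disjoint_sequence.
Context d (T : measurableType d) (R : realType).
Variables (mu : {measure set T -> \bar R}) (p : R) (p1 : (1 <= p%:E)%E).

Local Notation L := (LspaceType mu p1).
Local Notation class := (class mu p1).
Local Notation ind := (ind mu p1).
Local Notation rep := (@Lspace_repr d T R mu p%:E p1).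
Local Notation nonnull := (@nonnull _ T R mu).
Local Notation finite_measurable := (@finite_measurable _ T R mu).

Let p_gt0 := exponent_gt0 p1.

Definition level (f : T -> R) (c : R) := [set x | c < `|f x|].

Lemma measurable_level (f : T -> R) c : measurable_fun [set: T] f ->
  measurable (level f c).
Proof.
move=> mf; rewrite -[level f c]setTI.
apply: (@measurable_fun_ltr _ _ _ _ (cst c)) => //.
exact: measurableT_comp.
Qed.

(** Markov's inequality. *)
Lemma finite_level (f : T -> R) c : f \in Lfun mu p%:E -> 0 < c ->
  finite_measurable (level f c).
Proof.
move=> /(LfunE mu p1)[mf fy] c0; have ml := measurable_level c mf; split=> //.
rewrite -(@lte_pmul2l _ (c `^ p)%:E)// ?lte_fin ?powR_gt0//.
rewrite gt0_muley ?lte_fin ?powR_gt0//.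
apply: le_lt_trans fy; rewrite -integral_cst//.
apply: (@le_trans _ _ (\int[mu]_(x in level f c) (`|f x| `^ p)%:E)%E).
  apply: ge0_le_integral => //.
  - by move=> x _; rewrite lee_fin powR_ge0.
  - by apply: measurable_funTS; exact: measurable_powR_norm.
  - move=> x /= cx; rewrite lee_fin ge0_ler_powR ?nnegrE ?(ltW p_gt0)//.
      exact: ltW.
    exact: ltW.
apply: ge0_subset_integral => //.
exact: measurable_powR_norm.
Qed.


Lemma not_nonnull (A : set T) : finite_measurable A -> ~ nonnull A ->
  mu.-negligible A.
Proof.
move=> fA nA; case: (fA) => mA _; apply/(negligibleP _ mA).
apply: contrapT => /eqP A0; apply: nA; split=> //.
by rewrite lt0e A0 measure_ge0.
Qed.

Lemma nonnull_negligible (A : set T) : nonnull A -> ~ mu.-negligible A.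
Proof.
by move=> [[mA _] A0] /(negligibleP _ mA) A00; rewrite A00 ltxx in A0.
Qed.

Lemma nonnullI (A B : set T) : finite_measurable A -> measurable B ->
  ~ mu.-negligible (A `&` B) -> nonnull (A `&` B).
Proof.
move=> fA mB nAB; apply: contrapT => nn; apply: nAB.
by apply: not_nonnull nn; exact: finite_measurableI.
Qed.

Lemma level_negligible_restr0 (A : set T) (z : L) : measurable A ->
  (forall n, mu.-negligible (A `&` level (rep z) n.+1%:R^-1)) -> restr A z = 0.
Proof.
move=> mA null; apply: Lspace_ext; apply: ae_eq_trans (restrE _ mA) _.
apply: ae_eq_sym; apply: ae_eq_trans (Lrepr0 mu p1) _.
apply: negligibleS (negligible_bigcup null) => x nx.
have Ax : A x.
  apply: contrapT => nAx; apply: nx => _.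
  by rewrite indicE memNset// mul0r.
have zx : 0 < `|rep z x|.
  rewrite normr_gt0; apply: contra_notN nx => /eqP zx _.
  by rewrite zx mulr0.
have [n _ nz] := near_infty_natSinv_lt (PosNum zx).
by exists n => //; split=> //=; apply: nz => /=.
Qed.

(** Almost every value of [f] on an atom lies on the same side of every
    rational, and two reals on the same side of every rational are equal. *)
Lemma atom_const (A : set T) (f : T -> R) : measurable_fun [set: T] f ->
  ~ mu.-negligible A ->
  (forall C, measurable C ->
    mu.-negligible (A `&` C) \/ mu.-negligible (A `\` C)) ->
  exists c, mu.-negligible (A `&` [set x | f x != c]).
Proof.
move=> mf nA atomA.
pose below (q : rat) := [set x | f x < ratr q].
(* Of the two parts of [A] cut by a rational, the null one. *)
pose N n := if choice.unpickle n is Some q then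
  if pselect (mu.-negligible (A `&` below q)) then A `&` below q
  else A `\` below q else set0.
have negN n : mu.-negligible (N n).
  rewrite /N; case: choice.unpickle => [q|]; last exact: negligible_set0.
  case: pselect => // nq; case: (atomA (below q)) => //.
  rewrite -[below q]setTI.
  by apply: (@measurable_fun_ltr _ _ _ _ _ (cst (ratr q))).
have [x0 Ax0 nNx0] : exists2 x0, A x0 & ~ (\bigcup_n N n) x0.
  apply: contrapT => nx; apply: nA; apply: negligibleS (negligible_bigcup negN).
  by move=> x Ax; apply: contrapT => nNx; apply: nx; exists x.
have sep x y : A x -> A y -> f x < f y ->
    (\bigcup_n N n) x \/ (\bigcup_n N n) y.
  move=> Ax Ay /rat_in_itvoo[q]; rewrite in_itv/= => /andP[xq qy].
  have Nq : N (choice.pickle q) = if pselect (mu.-negligible (A `&` below q))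
      then A `&` below q else A `\` below q by rewrite /N choice.pickleK.
  move: (choice.pickle q) Nq => n Nq.
  have [nq|nq] := pselect (mu.-negligible (A `&` below q)).
    left; exists n => //; rewrite Nq; case: pselect => //=.
  right; exists n => //; rewrite Nq; case: pselect => //= _.
  by split=> //; apply/negP; rewrite -leNgt ltW.
exists (f x0); apply: negligibleS (negligible_bigcup negN) => x [Ax /= fx].
by case/lt_total/orP: fx => /sep[]//.
Qed.

Definition finitely_spanned (A : set T) :=
  exists2 F : set L, finite_set F & forall z, linear_span F (restr A z).

Lemma finitely_spannedU (A B : set T) : measurable A -> measurable B ->
  A `<=` B -> finitely_spanned A -> finitely_spanned (B `\` A) ->
  finitely_spanned B.
Proof.
move=> mA mB AB [F Ff FA] [G Gf GBA].
have span_sub (X Y : set L) : X `<=` Y -> linear_span X `<=` linear_span Y.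
  move=> XY; apply: linear_span_sub; first exact: linear_span_subspace.
  by apply: subset_trans XY _; exact: sub_linear_span.
exists (F `|` G) => [|z]; first by rewrite finite_setU.
rewrite (restr_setC (restr B z) mA) !restr_comp//; last exact: measurableC.
rewrite setIidl// setIC -setDE -[restr A z]scale1r.
have /linear_subspaceP[_] := linear_span_subspace (F `|` G).
apply; first by apply: (span_sub F); [exact: subsetUl|exact: FA].
by apply: (span_sub G); [exact: subsetUr|exact: GBA].
Qed.

Lemma finitely_spannedS (A B : set T) : measurable A -> measurable B ->
  A `<=` B -> finitely_spanned B -> finitely_spanned A.
Proof.
move=> mA mB AB [F Ff FB]; exists F => // z.
by rewrite -[A](setIidr AB) -restr_comp.
Qed.

Lemma not_finitely_spanned_nonnull (A : set T) : measurable A ->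
  ~ finitely_spanned A -> exists2 B, nonnull B & B `<=` A.
Proof.
move=> mA nA; apply: contrapT => nB; apply: nA; exists set0 => // z.
suff -> : restr A z = 0.
  by have /linear_subspaceP[] := linear_span_subspace (set0 : set L).
apply: level_negligible_restr0 => // n.
rewrite setIC; apply: contrapT => nn; apply: nB.
have fl : finite_measurable (level (rep z) n.+1%:R^-1).
  by apply: finite_level; first exact: Lrepr_Lfun.
by exists (level (rep z) n.+1%:R^-1 `&` A); [exact: nonnullI|exact: subIsetr].
Qed.

(** On an atom all functions are constant, so an atom is spanned by its
    indicator. *)
Lemma not_finitely_spanned_split (A : set T) :
  nonnull A -> ~ finitely_spanned A ->
  exists C, [/\ measurable C, nonnull (A `&` C) & nonnull (A `\` C)].
Proof.
move=> nnA nA; have [[mA muA] A0] := nnA; apply: contrapT => nsplit; apply: nA.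
have atomA C : measurable C ->
    mu.-negligible (A `&` C) \/ mu.-negligible (A `\` C).
  move=> mC; apply: contrapT => /not_orP[n1 n2].
  apply: nsplit; exists C; split=> //.
    exact: nonnullI.
  by rewrite setDE; apply: nonnullI; rewrite -?setDE//; exact: measurableC.
exists [set ind A]; first exact: finite_set1.
move=> z; have [c nc] :=
  atom_const (measurable_Lrepr z) (nonnull_negligible nnA) atomA.
have -> : restr A z = c *: ind A + 0.
  rewrite addr0; apply: Lspace_ext; apply: ae_eq_trans (restrE _ mA) _.
  apply: ae_eq_sym; apply: ae_eq_trans (LreprZ _ _) _.
  have {}nc : {ae mu, forall x, A x -> rep z x = c}.
    apply: negligibleS nc => x /not_implyP[Ax zx]; split=> //.
    exact/eqP.
  move: nc (classK p1 (Lfun_indic p1 (conj mA muA))).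
  apply: filterS2 => x zx iA xT; rewrite iA// indicE.
  case: (boolP (x \in A)) => [/set_mem/zx ->|_]; first by rewrite mulr1 mul1r.
  by rewrite mulr0 mul0r.
have /linear_subspaceP[V0 VZ] := linear_span_subspace [set ind A].
by apply: VZ => //; exact: sub_linear_span.
Qed.

(** A set that is not finitely spanned has a nonnull part whose complement in it
    is still not finitely spanned; removing such parts again and again gives the
    sequence. *)
Lemma infinite_disjoint_nonnull : infinite_dimensional L ->
  exists B : nat -> set T, (forall k, nonnull (B k)) /\ trivIset [set: nat] B.
Proof.
move=> Linf.
have nT : ~ finitely_spanned [set: T].
  move=> [F Ff FT]; apply: (Linf F) => //; apply/seteqP; split=> // z _.
  by rewrite -(restr_setT z).
pose big A := measurable A /\ ~ finitely_spanned A.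
have /choice[b bP] (A : set T) : exists B, big A ->
    [/\ nonnull B, B `<=` A & big (A `\` B)].
  have [[mA nA]|] := pselect (big A); last by exists set0.
  have [B nnB BA] := not_finitely_spanned_nonnull mA nA.
  have [[mB muB] B0] := nnB.
  have [fAB|nAB] := pselect (finitely_spanned (A `\` B)); last first.
    by exists B => _; split=> //; split=> //; exact: measurableD.
  have nB : ~ finitely_spanned B.
    by move=> fB; apply: nA; exact: (finitely_spannedU mB mA BA).
  have [C [mC nnBC nnBDC]] := not_finitely_spanned_split nnB nB.
  have mBC := measurableI _ _ mB mC; have mBDC := measurableD mB mC.
  have [fBC|nBC] := pselect (finitely_spanned (B `&` C)).
    exists (B `&` C) => _; split=> //; first by move=> x [/BA].
    split; first exact: measurableD.
    apply: contra_not nB => fAD; apply: (finitely_spannedU mBC mB) => //.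
    apply: finitely_spannedS fAD; [exact: measurableD|exact: measurableD|].
    by move=> x [/BA].
  exists (B `\` C) => _; split=> //; first by move=> x [/BA].
  split; first exact: measurableD.
  apply: contra_not nBC => fAD.
  apply: finitely_spannedS fAD; [exact: measurableI|exact: measurableD|].
  by move=> x [/BA Ax Cx]; split=> // -[].
pose A n := iter n (fun A => A `\` b A) [set: T].
have bigA n : big (A n).
  by elim: n => [|n /bP[] _ _ //]; exact: (conj measurableT nT).
exists (b \o A); split=> [k|]; first by case: (bP _ (bigA k)).
have decr m n : (m <= n)%N -> A n `<=` A m.
  move=> /subnK <-; elim: (n - m)%N => [//|k IH].
  by rewrite addSn; apply: subset_trans IH; exact: subDsetl.
have disj m n : (m < n)%N -> b (A m) `&` b (A n) = set0.
  move=> mn; apply/seteqP; split=> // x [bm bn].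
  have [_ bA _] := bP _ (bigA n).
  by have [] := decr _ _ mn _ (bA _ bn).
apply/trivIsetP => m n _ _; rewrite neq_ltn => /orP[/disj//|/disj].
by rewrite setIC.
Qed.

Lemma finite_dens_small (Z : set L) (eta : R) : infinite_dimensional L ->
  finite_set (dens Z) -> 0 < eta ->
  exists2 B, nonnull B & forall z, Z z -> `|restr B z| <= eta * `|z|.
Proof.
move=> Linf Zf eta0.
have [B [nnB tB]] := infinite_disjoint_nonnull Linf.
have mB k : measurable (B k) by case: (nnB k) => -[].
have [k _ Bk] := finite_span_small mB tB Zf eta0.
exists (B k) => // z Zz; apply: (Bk k) => //=.
by have [[_ Zd] _] := densP Z; exact: Zd.
Qed.

End disjoint_sequence.

(** * Sets that are thin with respect to a sub-sigma-algebra *)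

Lemma ge0_integral_mrestr d (T : measurableType d) (R : realType)
    (mu : {measure set T -> \bar R}) (A : set T) (mA : measurable A)
    (f : T -> \bar R) : measurable_fun [set: T] f -> (forall x, 0 <= f x)%E ->
  (\int[mrestr mu mA]_x f x = \int[mu]_(x in A) f x)%E.
Proof.
move=> mf f0; have mCA := measurableC mA.
rewrite -(setUv A) ge0_integral_setU//; last 2 first.
- by rewrite setUv.
- by apply/disj_setPS; rewrite setICr.
rewrite (@eq_measure_integral _ _ _ A mu); last first.
  by move=> B mB BA /=; rewrite /mrestr setIidl.
rewrite [X in (_ + X)%E](@eq_measure_integral _ _ _ (~` A) mzero); last first.
  move=> B mB BA /=; rewrite /mrestr (_ : B `&` A = set0) ?measure0//.
  by apply/disjoints_subset.
by rewrite integral_measure_zero adde0.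
Qed.

Section sub_sigma_algebra.
Context d (T : measurableType d) (R : realType).
Variables (mu : {measure set T -> \bar R}) (G : set (set T)).
Hypothesis GM : G `<=` @measurable d T.

Local Notation T0 := (g_sigma_algebraType G).
Local Notation nonnull := (@nonnull _ T R mu).
Local Notation finite_measurable := (@finite_measurable _ T R mu).

Lemma g_sigma_algebra_sub : <<s G>> `<=` @measurable d T.
Proof. by apply: smallest_sub => //; exact: sigma_algebra_measurable. Qed.

Lemma measurable_id_g_sigma_algebra : measurable_fun [set: T] (id : T -> T0).
Proof. by move=> _ F GF; rewrite setTI; exact: g_sigma_algebra_sub. Qed.

(** The inclusion of [G] is an argument because the proofs that the restriction
    of [nu] to [<<s G>>] is a charge depend on it. *)
Definition sub_charge of G `<=` @measurable d T :=
  fun nu : set T -> \bar R => nu : set T0 -> \bar R.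

Section sub_charge.
Variable nu : {charge set T -> \bar R}.
Local Notation nu0 := (sub_charge GM nu).

Let sub_charge0 : nu0 set0 = 0%E. Proof. exact: charge0. Qed.

Let sub_charge_finite F : measurable F -> nu0 F \is a fin_num.
Proof. by move=> GF; apply: fin_num_measure; exact: g_sigma_algebra_sub. Qed.

Let sub_charge_sigma_additive : semi_sigma_additive nu0.
Proof.
move=> F GF tF GUF; apply: charge_semi_sigma_additive => //.
- by move=> n; apply: g_sigma_algebra_sub; exact: GF.
- exact: g_sigma_algebra_sub.
Qed.

HB.instance Definition _ := isCharge.Build _ T0 R nu0
  sub_charge0 sub_charge_finite sub_charge_sigma_additive.

End sub_charge.

(** For the trivial sigma-algebra [<<s G>>], these are the usual atoms and the
    null sets. *)
Definition relative_atom (B : set T) := forall C, measurable C -> C `<=` B ->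
  exists F, [/\ <<s G>> F, mu.-negligible (C `\` F) &
    mu.-negligible ((B `&` F) `\` C)].

Definition thin_in (c : R) (B A : set T) :=
  forall F, <<s G>> F -> (mu (B `&` F) <= c%:E * mu (A `&` F))%E.

(** On a negative set [N] of the charge [mu (C & -) - mu (B \ C & -)], the part
    [C] of [B] has at most half of the measure of [B], and on its complement
    [P] so has [B \ C]. Both [C & N] and [(B \ C) & P] are null only if
    [C = B & P] up to null sets. *)
Lemma exists_half (B : set T) : nonnull B -> ~ relative_atom B ->
  exists B', [/\ nonnull B', B' `<=` B & thin_in 2^-1 B' B].
Proof.
move=> [[mB muB] B0] nB.
have [C [mC CB nC]] : exists C, [/\ measurable C, C `<=` B &
    forall F, <<s G>> F -> mu.-negligible (C `\` F) ->
      ~ mu.-negligible ((B `&` F) `\` C)].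
  apply: contrapT => nex; apply: nB => C mC CB; apply: contrapT => nF.
  apply: nex; exists C; split=> // F GF n1 n2; apply: nF.
  by exists F.
pose C' := B `\` C; have mC' : measurable C' by exact: measurableD.
have muC : (mu C < +oo)%E by apply: le_lt_trans muB; rewrite le_measure ?inE.
have muC' : (mu C' < +oo)%E.
  by apply: le_lt_trans muB; rewrite le_measure ?inE//; exact: subDsetl.
pose nu := cadd (charge_of_finite_measure (mfrestr mC muC))
  (copp (charge_of_finite_measure (mfrestr mC' muC'))).
have nuE F : nu F = (mu (C `&` F) - mu (C' `&` F))%E.
  by rewrite [C `&` F]setIC [C' `&` F]setIC.
have fin D F : measurable D -> (mu D < +oo)%E -> measurable F ->
    mu (D `&` F) \is a fin_num.
  move=> mD muD mF; rewrite ge0_fin_numE//; apply: le_lt_trans muD.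
  by rewrite le_measure ?inE//; exact: measurableI.
have half D D' N : measurable D -> measurable D' -> D `<=` B -> D' `<=` B ->
    D `&` D' = set0 -> <<s G>> N -> ~ mu.-negligible (D `&` N) ->
    (forall F, <<s G>> F -> F `<=` N -> (mu (D `&` F) <= mu (D' `&` F))%E) ->
    exists B', [/\ nonnull B', B' `<=` B & thin_in 2^-1 B' B].
  move=> mD mD' DB D'B DD' GN nDN le_DD'; have mN := g_sigma_algebra_sub GN.
  have muD : (mu D < +oo)%E by apply: le_lt_trans muB; rewrite le_measure ?inE.
  exists (D `&` N); split; [exact: nonnullI|by move=> x [/DB]|move=> F GF].
  have mF := g_sigma_algebra_sub GF.
  have mNF : measurable (N `&` F) by exact: measurableI.
  have mDNF := measurableI _ _ mD mNF; have mD'NF := measurableI _ _ mD' mNF.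
  rewrite -setIA lee_pdivlMl// (_ : 2%:E = (1 + 1)%E :> \bar R)//.
  rewrite ge0_muleDl// mul1e.
  apply: (@le_trans _ _ (mu (D `&` (N `&` F)) + mu (D' `&` (N `&` F)))%E).
    rewrite leeD2l//; apply: le_DD'; last exact: subIsetl.
    exact: (@measurableI _ T0).
  rewrite -measureU//; last by rewrite setIACA DD' set0I.
  apply: le_measure; rewrite ?inE; [exact: measurableU|exact: measurableI|].
  by move=> x [[/DB Bx [_ Fx]]|[/D'B Bx [_ Fx]]].
have [P [N [[GP Ppos] [GN Nneg] PUN PIN]]] :=
  Hahn_decomposition (sub_charge GM nu).
have [negN|negN] := pselect (mu.-negligible (C `&` N)); last first.
  apply: (half C C' N) => //; [exact: subDsetl|by rewrite setDIK|].
  move=> F GF FN; have mF := g_sigma_algebra_sub GF.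
  have : (nu F <= 0)%E := Nneg F GF FN; rewrite nuE.
  by rewrite sube_le0.
apply: (half C' C P) => //; [exact: subDsetl|by rewrite setIC setDIK| |].
  have NC x : ~ P x -> N x.
    by have : (P `|` N) x by [rewrite PUN]; case.
  apply: contra_not (nC P GP _).
    by apply: negligibleS => x [[Bx Px] nCx].
  by apply: negligibleS negN => x [Cx /NC].
move=> F GF FP; have mF := g_sigma_algebra_sub GF.
have : (0 <= nu F)%E := Ppos F GF FP; rewrite nuE.
by rewrite sube_ge0// fin.
Qed.

(** Halve [k] times. *)
Lemma exists_thin (A : set T) (k : nat) : nonnull A ->
  (forall B, nonnull B -> B `<=` A -> ~ relative_atom B) ->
  exists B, [/\ nonnull B, B `<=` A & thin_in (2^-1 ^+ k) B A].
Proof.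
move=> nnA natom; elim: k => [|k [B [nnB BA Bk]]].
  by exists A; split=> // F _; rewrite expr0 mul1e.
have [B' [nnB' B'B B'half]] := exists_half nnB (natom B nnB BA).
exists B'; split=> //; first exact: subset_trans BA.
move=> F GF; apply: (le_trans (B'half F GF)).
by rewrite exprS EFinM -muleA lee_wpmul2l ?lee_fin ?invr_ge0//; exact: Bk.
Qed.

(** The two integrals are those of [f] for the restrictions to [<<s G>>] of the
    traces of [mu] on [B] and [A], and thinness compares these measures. *)
Lemma thin_in_integral (c : R) (B A : set T) (f : T0 -> \bar R) : 0 <= c ->
  measurable A -> measurable B -> thin_in c B A ->
  measurable_fun [set: T0] f -> (forall x, 0 <= f x)%E ->
  (\int[mu]_(x in B) f x <= c%:E * \int[mu]_(x in A) f x)%E.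
Proof.
move=> c0 mA mB thin mf f0; pose mid := measurable_id_g_sigma_algebra.
have mfT : measurable_fun [set: T] (f : T -> \bar R).
  exact: (measurableT_comp mf mid).
have push D (mD : measurable D) : (\int[mu]_(x in D) f x =
    \int[pushforward (mrestr mu mD) (id : T -> T0)]_x f x)%E.
  by rewrite (ge0_integral_pushforward mid)// preimage_setT ge0_integral_mrestr.
rewrite (push B mB) (push A mA).
rewrite -(ge0_integral_mscale _ measurableT (NngNum c0))//.
apply: ge0_le_measure_integral => //= F GF.
by have := thin F GF; rewrite [B `&` F]setIC [A `&` F]setIC.
Qed.

Variables (p : R) (p1 : (1 <= p%:E)%E).
Local Notation L := (LspaceType mu p1).
Local Notation rep := (@Lspace_repr d T R mu p%:E p1).

Let p_gt0 := exponent_gt0 p1.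

Definition g_sigma_measurable : set L := [set z |
  exists2 g : T -> R, measurable_fun [set: T0] (g : T0 -> R) &
    rep z = g %[ae mu]].

Lemma g_sigma_measurable_subspace : linear_subspace g_sigma_measurable.
Proof.
apply/linear_subspaceP; split.
  by exists (cst 0); [exact: measurable_cst|exact: Lrepr0].
move=> a y z [f mf yf] [g mg zg]; exists (fun x => a * f x + g x).
  by apply: measurable_funD => //; exact: measurable_funM.
apply: ae_eq_trans (LreprD _ _) _.
move: (LreprZ a y) yf zg; apply: filterS3 => x ey yf zg xT.
by rewrite ey// yf// zg.
Qed.

Lemma thin_in_norm (c : R) (B A : set T) (z : L) : 0 <= c ->
  measurable A -> measurable B -> thin_in c B A -> g_sigma_measurable z ->
  `|restr B z| `^ p <= c * `|restr A z| `^ p.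
Proof.
move=> c0 mA mB thin [g mg zg]; rewrite -lee_fin EFinM !restr_norm_powR//.
have mgT : measurable_fun [set: T] g.
  exact: (measurableT_comp mg measurable_id_g_sigma_algebra).
have E D : measurable D -> (\int[mu]_(x in D) (`|rep z x| `^ p)%:E =
    \int[mu]_(x in D) (`|g x| `^ p)%:E)%E.
  move=> mD; apply: ae_eq_integral => //.
  - apply: measurable_funTS.
    exact: measurable_powR_norm (measurable_Lrepr z).
  - by apply: measurable_funTS; exact: measurable_powR_norm.
  - by apply: filterS zg => x zg _; rewrite zg.
rewrite !E//; apply: thin_in_integral => //.
by apply: (@measurable_powR_norm _ T0).
Qed.

(** If [A] contains no nonnull relative atom, some part [B] of it is so thin in [A] that
    all of the [<<s G>>]-measurable elements almost vanish on [B]. *)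
Lemma no_relative_atom_small (A : set T) (Z : set L) (eta : R) : nonnull A ->
  (forall B, nonnull B -> B `<=` A -> ~ relative_atom B) ->
  Z `<=` closure g_sigma_measurable -> 0 < eta ->
  exists2 B, nonnull B & forall z, Z z -> `|restr B z| <= eta * `|z|.
Proof.
move=> nnA natom Zcl eta0.
have [k _ kP] := near_infty_natSinv_expn_lt (PosNum (powR_gt0 p eta0)).
have /= {}kP := kP k (leqnn k).
have [B [nnB BA Bthin]] := exists_thin k nnA natom.
have [[mA _] _] := nnA; have [[mB _] _] := nnB.
exists B => // z /Zcl; apply: restr_le_closure => //; first exact: ltW.
move=> {}z Gz; apply: (powR_le_inv p1); first by rewrite mulr_ge0// ltW.
rewrite powRM ?(ltW eta0)//.
apply: le_trans (thin_in_norm _ mA mB Bthin Gz) _; first by rewrite exprn_ge0.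
rewrite ler_pM ?exprn_ge0 ?powR_ge0//.
  by rewrite exprVn -div1r ltW.
by rewrite ge0_ler_powR ?nnegrE ?restr_norm_le ?(ltW p_gt0).
Qed.

End sub_sigma_algebra.

(** * Exhaustion, and density of indicators *)

Section indicators.
Context d (T : measurableType d) (R : realType).
Variables (mu : {measure set T -> \bar R}) (p : R) (p1 : (1 <= p%:E)%E).

Local Notation L := (LspaceType mu p1).
Local Notation class := (class mu p1).
Local Notation ind := (ind mu p1).
Local Notation rep := (@Lspace_repr d T R mu p%:E p1).
Local Notation nonnull := (@nonnull _ T R mu).
Local Notation finite_measurable := (@finite_measurable _ T R mu).

(** The measure of the part of [A] covered by countably many members of [P] has
    a supremum, which is attained, since the union of countably many countable
    families is countable; no member of [P] can then cover more. *)
Lemma exhaustion (A : set T) (P : set (set T)) : finite_measurable A ->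
  P `<=` measurable -> P !=set0 -> exists B : nat -> set T,
    (forall i, P (B i)) /\
    forall C, P C -> mu.-negligible ((A `&` C) `\` \bigcup_i B i).
Proof.
move=> [mA muA] mP [P0 PP0].
pose m (U : set T) := fine (mu (A `&` U)).
have fin U : measurable U -> mu (A `&` U) \is a fin_num.
  move=> mU; rewrite ge0_fin_numE//; apply: le_lt_trans muA.
  by rewrite le_measure ?inE//; exact: measurableI.
have mbig (B : nat -> set T) :
    (forall i, P (B i)) -> measurable (\bigcup_i B i).
  by move=> PB; apply: bigcupT_measurable => i; exact: mP.
have mle U V : measurable U -> measurable V -> U `<=` V -> m U <= m V.
  move=> mU mV UV; rewrite /m fine_le ?fin// le_measure ?inE//;
    [exact: measurableI|exact: measurableI|].
  by move=> x [Ax /UV].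
pose E :=
  [set m (\bigcup_i B i) | B in [set B : nat -> set T | forall i, P (B i)]].
have supE : has_sup E.
  split; first by exists (m (\bigcup_(i in [set: nat]) P0)); exists (fun=> P0).
  exists (m setT) => _ [B PB <-]; apply: mle => //; exact: mbig.
have /choice[B PB] (n : nat) : exists B : nat -> set T, (forall i, P (B i)) /\
    sup E - n.+1%:R^-1 < m (\bigcup_i B i).
  have n0 : 0 < n.+1%:R^-1 :> R by rewrite invr_gt0.
  by have [_ [B PB <-] ltB] := sup_adherent n0 supE; exists B.
pose B' k := if choice.unpickle k is Some ni then B ni.1 ni.2 else P0.
have PB' i : P (B' i).
  by rewrite /B'; case: choice.unpickle => // ni; case: (PB ni.1).
have supB' : m (\bigcup_i B' i) = sup E.
  apply/eqP; rewrite eq_le; apply/andP; split.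
    by apply: ub_le_sup; [case: supE|exists B'].
  apply/ler_addgt0Pr => e e0.
  have [n _ /(_ n (leqnn n)) /= ne] := near_infty_natSinv_lt (PosNum e0).
  rewrite -lerBlDr; apply: le_trans (ltW _) (_ : m (\bigcup_i B n i) <= _).
    by apply: le_lt_trans (PB n).2; rewrite lerB// ltW.
  apply: mle; [exact: mbig (PB n).1|exact: mbig|].
  move=> x [i _ Bx]; exists (choice.pickle (n, i)) => //.
  by rewrite /B' choice.pickleK.
exists B'; split=> // C PC; have mC := mP _ PC.
set U := \bigcup_i B' i; have mU : measurable U by exact: mbig.
have mUC : measurable (U `|` C) by exact: measurableU.
have le_sup : m (U `|` C) <= m U.
  rewrite supB'; apply: ub_le_sup; first by case: supE.
  exists (fun i => if i is j.+1 then B' j else C) => [[]//|].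
  congr m; apply/seteqP; split=> x.
    by move=> [[_ Cx|j _ Bx]]; [right|left; exists j].
  by move=> [[j _ Bx]|Cx]; [exists j.+1|exists 0%N].
have mD : measurable ((A `&` C) `\` U).
  by apply: measurableD => //; exact: measurableI.
apply/negligibleP => //; apply/eqP; rewrite -measure_le0.
have muE : mu (A `&` (U `|` C)) = (mu (A `&` U) + mu ((A `&` C) `\` U))%E.
  rewrite -measureU//.
  - congr (mu _); apply/seteqP; split=> x.
      move=> [Ax UCx]; have [Ux|nUx] := pselect (U x); [by left|right].
      by case: UCx.
    by move=> [[Ax Ux]|[[Ax Cx] _]]; split=> //; [left|right].
  - exact: measurableI.
  - by apply/seteqP; split=> // x [[_ Ux] [_ nUx]].
have := le_sup; rewrite /m -lee_fin !fineK ?fin// muE.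
by rewrite -[leRHS]adde0 leeD2lE// fin.
Qed.

Lemma ind_setU (A B : set T) : finite_measurable A -> finite_measurable B ->
  A `&` B = set0 -> ind (A `|` B) = ind A + ind B.
Proof.
move=> fA fB AB; rewrite -classD ?Lfun_indic//; congr class.
apply/funext => x; rewrite !indicE in_setU.
case: (boolP (x \in A)) => xA; case: (boolP (x \in B)) => xB /=;
  rewrite ?addr0 ?add0r//.
have : (A `&` B) x by split; exact: set_mem.
by rewrite AB.
Qed.

Lemma eq_ind (A B : set T) : finite_measurable A -> finite_measurable B ->
  mu.-negligible (A `\` B) -> mu.-negligible (B `\` A) -> ind A = ind B.
Proof.
move=> fA fB nAB nBA; apply: eq_class; [exact: Lfun_indic|exact: Lfun_indic|].
apply: negligibleS (negligibleU nAB nBA) => x nx.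
have [Ax|nAx] := pselect (A x); have [Bx|nBx] := pselect (B x).
- by exfalso; apply: nx => _; rewrite !indicE !mem_set.
- by left.
- by right.
- by exfalso; apply: nx => _; rewrite !indicE !memNset.
Qed.

Variable V : set L.
Hypotheses (Vlin : linear_subspace V) (Vclosed : closure V `<=` V).

Lemma subspace_dominated (f : nat -> T -> R) (g h : T -> R) :
  h \in Lfun mu p%:E -> (forall n, measurable_fun [set: T] (f n)) ->
  (forall x, f n x @[n --> \oo] --> g x) -> (forall n x, `|f n x| <= `|h x|) ->
  (forall n, V (class (f n))) -> V (class g).
Proof.
move=> hL mf fg fh Vf; apply: Vclosed; apply/closure_normP => e e0.
have [n _ /(_ n (leqnn n)) /= fn] := dominated_class p1 hL mf fg fh e0.
by exists (class (f n)) => //; rewrite distrC.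
Qed.

Lemma subspaceD x y : V x -> V y -> V (x + y).
Proof.
move=> Vx Vy; have /linear_subspaceP[_ VZ] := Vlin.
by rewrite -[x]scale1r; exact: VZ.
Qed.

Lemma subspaceZ a x : V x -> V (a *: x).
Proof.
move=> Vx; have /linear_subspaceP[V0 VZ] := Vlin.
by rewrite -[_ *: _]addr0; exact: VZ.
Qed.

Lemma subspaceB x y : V x -> V y -> V (x - y).
Proof.
by move=> Vx Vy; rewrite -scaleN1r; apply: subspaceD => //; exact: subspaceZ.
Qed.

Lemma subspace_ind_bigcup (A : nat -> set T) : nondecreasing_seq A ->
  (forall n, measurable (A n)) -> finite_measurable (\bigcup_n A n) ->
  (forall n, V (ind (A n))) -> V (ind (\bigcup_n A n)).
Proof.
move=> Aincr mA fA VA.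
apply: (subspace_dominated (Lfun_indic p1 fA) _ _ _ VA) => [n|x|n x].
- by [].
- apply: cvg_near_cst; have [[j _ Ajx]|nAx] := pselect ((\bigcup_n A n) x).
    exists j => // n /= jn; rewrite !indicE !mem_set//; first by exists j.
    by have /subsetPset := Aincr _ _ jn; exact.
  apply: nearW => n; rewrite !indicE !memNset// => Anx; apply: nAx.
  by exists n.
- rewrite !indicE; case: (boolP (x \in A n)) => [/set_mem Anx|_].
    by rewrite mem_set//; exists n.
  by rewrite normr0.
Qed.

Hypothesis Vind : forall A, finite_measurable A -> V (ind A).

Import HBNNSimple.

Lemma subspace_simple (h : {nnsfun T >-> R}) : (h : T -> R) \in Lfun mu p%:E ->
  V (class h).
Proof.
move=> hL.
have V0 : V 0 by have /linear_subspaceP[] := Vlin.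
have term y : (fun x => y * \1_(h @^-1` [set y]) x) \in Lfun mu p%:E /\
    V (class (fun x => y * \1_(h @^-1` [set y]) x)).
  have [->|y0] := eqVneq y 0.
    have -> : (fun x : T => (0 : R) * \1_(h @^-1` [set 0]) x) = cst 0.
      by apply/funext => x; rewrite mul0r.
    by rewrite class0; split=> //; exact: Lfun0.
  have fy : finite_measurable (h @^-1` [set y]).
    have c0 : 0 < `|y| / 2 by rewrite divr_gt0// normr_gt0.
    have -> : h @^-1` [set y] = level h (`|y| / 2) `&` h @^-1` [set y].
      apply/esym/setIidr => x /= hx.
      by rewrite /level/= hx ltr_pdivrMr// ltr_pMr ?normr_gt0// ltr1n.
    by apply: finite_measurableI => //; exact: (finite_level p1 hL).
  split; last by rewrite classZ ?Lfun_indic//; apply: subspaceZ; exact: Vind.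
  exact: (LfunZ p1 _ (Lfun_indic p1 fy)).
have sum (s : seq R) :
    (fun x => \sum_(y <- s) y * \1_(h @^-1` [set y]) x) \in Lfun mu p%:E /\
    V (class (fun x => \sum_(y <- s) y * \1_(h @^-1` [set y]) x)).
  elim: s => [|y s [sL sV]].
    have -> : (fun x => \sum_(y <- [::]) y * \1_(h @^-1` [set y]) x) = cst 0.
      by apply/funext => x; rewrite big_nil.
    by rewrite class0; split=> //; exact: Lfun0.
  have [yL yV] := term y.
  have -> : (fun x => \sum_(y <- y :: s) y * \1_(h @^-1` [set y]) x) =
      (fun x => y * \1_(h @^-1` [set y]) x +
        \sum_(y <- s) y * \1_(h @^-1` [set y]) x).
    by apply/funext => x; rewrite big_cons.
  split; first exact: (rpredD yL sL).
  by rewrite classD//; exact: subspaceD.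
pose values := finmap.enum_fset (fset_set (range h)).
suff -> : (h : T -> R) =
    (fun x => \sum_(y <- values) y * \1_(h @^-1` [set y]) x).
  by case: (sum values).
by apply/funext => x; rewrite [LHS]fimfunE fsbig_finite.
Qed.

Lemma subspace_nonneg (f : T -> R) : f \in Lfun mu p%:E ->
  (forall x, 0 <= f x) -> V (class f).
Proof.
move=> fL f0; have [mf _] := iffLR (LfunE mu p1 f) fL.
have mfE : measurable_fun [set: T] (EFin \o f) by exact/measurable_EFinP.
pose h := nnsfun_approx measurableT mfE.
have fE0 x : [set: T] x -> (0 <= (EFin \o f) x)%E by rewrite lee_fin.
have hf n x : `|h n x| <= `|f x|.
  by rewrite !ger0_norm// -lee_fin nnsfun_approxE le_approx.
have mh n : measurable_fun [set: T] (h n) by [].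
apply: (subspace_dominated fL mh _ hf) => [x|n].
  have := cvg_nnsfun_approx measurableT mfE fE0 (I : [set: T] x).
  by move=> /fine_cvgP[].
by apply: subspace_simple; exact: (Lfun_le p1 (mh n) fL (hf n)).
Qed.

(** Simple functions below [z] approximate its positive and negative parts. *)
Lemma subspace_ind_full z : V z.
Proof.
have zL := Lrepr_Lfun z; have mz := measurable_Lrepr z.
pose pos x := Num.max (rep z x) 0; pose neg x := Num.max (- rep z x) 0.
have posL : pos \in Lfun mu p%:E.
  apply: (Lfun_le p1 _ zL) => [|x]; first exact: measurable_maxr.
  by rewrite /pos; case: (leP (rep z x) 0) => // _; rewrite normr0.
have negL : neg \in Lfun mu p%:E.
  apply: (Lfun_le p1 _ zL) => [|x].
    by apply: measurable_maxr => //; exact: measurableT_comp.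
  by rewrite /neg; case: (leP (- rep z x) 0) => _; rewrite ?normr0 ?normrN.
have -> : z = class pos - class neg.
  rewrite -scaleN1r -classZ// -classD//; last first.
    exact: (LfunZ p1 _ negL).
  rewrite -[LHS]class_Lrepr; congr class; apply/funext => x.
  rewrite /pos /neg mulN1r.
  case: (ltgtP (rep z x) 0) => zx.
  - by rewrite max_l ?opprK ?add0r// oppr_ge0 ltW.
  - by rewrite max_r ?subr0// oppr_le0 ltW.
  - by rewrite zx oppr0 maxxx subr0.
apply: subspaceB; apply: subspace_nonneg => // x.
- by rewrite /pos le_max lexx orbT.
- by rewrite /neg le_max lexx orbT.
Qed.

End indicators.

(** * Subspaces of infinite density *)

Section infinite_density.
Context d (T : measurableType d) (R : realType).
Variables (mu : {measure set T -> \bar R}) (p : R) (p1 : (1 <= p%:E)%E).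

Local Notation L := (LspaceType mu p1).
Local Notation ind := (ind mu p1).
Local Notation rep := (@Lspace_repr d T R mu p%:E p1).
Local Notation nonnull := (@nonnull _ T R mu).
Local Notation finite_measurable := (@finite_measurable _ T R mu).

Variable D : set L.

(** With rational thresholds and finitely many conditions, there are no more
    cylinders than elements of [D], if [D] is infinite. *)
Definition cylinder (s : seq (D * rat)) : set T :=
  foldr (fun zq A => [set x | ratr zq.2 < rep (val zq.1) x] `&` A) setT s.

Let G := range cylinder.

Lemma measurable_gtr (f : T -> R) c : measurable_fun [set: T] f ->
  measurable [set x | c < f x].
Proof.
move=> mf; rewrite -[X in measurable X]setTI.
exact: (@measurable_fun_ltr _ _ _ _ (cst c)).
Qed.

Let GM : G `<=` measurable.
Proof.
move=> _ [s _ <-]; elim: s => [|[z q] s IH] //=.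
by apply: measurableI => //; exact: measurable_gtr (measurable_Lrepr _).
Qed.

Let GI : setI_closed G.
Proof.
move=> _ _ [s _ <-] [t _ <-]; exists (s ++ t) => //.
by elim: s => [|zq s IH] /=; [rewrite setTI|rewrite IH setIA].
Qed.

(** Rational thresholds are enough to generate the sets [{z > a}], [a] real. *)
Lemma sub_g_sigma_measurable : D `<=` @g_sigma_measurable d T R mu G p p1.
Proof.
move=> z Dz; exists (rep z); last exact: ae_eq_refl.
apply: (measurability _ (RGenOInfty.measurableE R)) => //.
move=> _ [_ [a ->] <-]; rewrite setTI.
have -> : rep z @^-1` `]a, +oo[%classic =
    \bigcup_(q in [set q : rat | a < ratr q]) [set x | ratr q < rep z x].
  apply/seteqP; split=> x /=; rewrite in_itv/= andbT.
    by move=> /rat_in_itvoo[q]; rewrite in_itv/= => /andP[aq qz]; exists q.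
  by move=> [q /= aq qz]; exact: lt_trans aq qz.
rewrite bigcup_mkcond; apply: bigcupT_measurable_rat => q.
case: ifP => // _; apply: sub_sigma_algebra.
exists [:: (SigSub (mem_set Dz), q)] => //=.
by rewrite setIT.
Qed.

Local Notation atom := (relative_atom mu G).

Lemma relative_atom0 : atom set0.
Proof.
move=> C mC; rewrite subset0 => ->; exists set0; split.
- exact: sigma_algebra0.
- by rewrite set0D; exact: negligible_set0.
- by rewrite !set0I set0D; exact: negligible_set0.
Qed.

(** The elements that vanish on [S] form a closed subspace, which contains [D]. *)
Lemma level_miss_small (S : set T) (Z : set L) (eta : R) : nonnull S ->
  Z `<=` closure (linear_span D) -> 0 < eta ->
  (forall z n, D z -> mu.-negligible (S `&` level (rep z) n.+1%:R^-1)) ->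
  exists2 B, nonnull B & forall z, Z z -> `|restr B z| <= eta * `|z|.
Proof.
move=> nnS ZD eta0 miss; have [[mS _] _] := nnS.
have restr_lin : linear_subspace [set z : L | restr S z = 0].
  apply/linear_subspaceP; split=> /=.
    by rewrite -[X in restr S X](scale0r 0) restrZ// scale0r.
  by move=> a x y x0 y0; rewrite restrD// restrZ// x0 y0 scaler0 addr0.
exists S => // z /ZD; apply: restr_le_closure => //; first exact: ltW.
move=> {}z zD; suff -> : restr S z = 0 by rewrite normr0 mulr_ge0// ltW.
apply: (linear_span_sub restr_lin _ zD) => y Dy /=.
by apply: level_negligible_restr0 => // n; exact: miss.
Qed.

(** If no set is small for [Z], countably many relative atoms cover each level
    set of an element of [D], and countably many such level sets cover each set
    of finite measure. The indicators of the traces of cylinders on these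
    relative atoms then span a dense subspace, and there are no more of them
    than elements of [D]. *)
Lemma infinite_density_small (Z : set L) (eta : R) : infinite_set D ->
  Z `<=` closure (linear_span D) -> ~~ (dens [set: L] #<= D)%card -> 0 < eta ->
  exists2 B, nonnull B & forall z, Z z -> `|restr B z| <= eta * `|z|.
Proof.
move=> Dinf ZD densD eta0; apply: contrapT => nsmall.
have GsubM := g_sigma_algebra_sub GM.
have has_atom A : nonnull A -> exists B, [/\ nonnull B, B `<=` A & atom B].
  move=> nnA; apply: contrapT => nB; apply: nsmall.
  apply: (no_relative_atom_small (G := G) GM nnA _ _ eta0).
    by move=> B nnB BA atB; apply: nB; exists B.
  apply: subset_trans ZD _; apply: closure_subset.
  apply: linear_span_sub; last exact: sub_g_sigma_measurable.
  exact: g_sigma_measurable_subspace.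
have has_level S : nonnull S ->
    exists z n, D z /\ ~ mu.-negligible (S `&` level (rep z) n.+1%:R^-1).
  move=> nnS; apply: contrapT => nzn; apply: nsmall.
  apply: (level_miss_small nnS) => // z n Dz; apply: contrapT => nn.
  by apply: nzn; exists z, n.
pose lev z n := level (rep z) n.+1%:R^-1.
have flev z n : finite_measurable (lev z n).
  by apply: (finite_level p1 (Lrepr_Lfun z)); rewrite invr_gt0.
have /choice[b bP] (zn : L * nat) : exists b : nat -> set T,
    [/\ forall i, finite_measurable (b i) /\ atom (b i) &
      mu.-negligible (lev zn.1 zn.2 `\` \bigcup_i b i)].
  case: zn => z n /=; have [mlev _] := flev z n.
  have [||b [bP bmax]] := @exhaustion _ _ _ mu (lev z n)
      [set B | finite_measurable B /\ atom B] (flev z n).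
  - by move=> B [[]].
  - exists set0; split; last exact: relative_atom0.
    by split=> //; rewrite measure0.
  exists b; split=> //.
  have mb : measurable (\bigcup_i b i).
    by apply: bigcupT_measurable => i; case: (bP i) => -[].
  apply: contrapT => nn.
  have [B [nnB BA atB]] : exists B,
      [/\ nonnull B, B `<=` lev z n `\` \bigcup_i b i & atom B].
    apply: has_atom; rewrite setDE; apply: nonnullI => //.
    exact: measurableC.
  apply: (nonnull_negligible nnB).
  apply: negligibleS (bmax B (conj (proj1 nnB) atB)) => x Bx.
  by have [lx nbx] := BA x Bx.
(* [b (z, n) i] is the [i]-th relative atom in the level set number [n] of
   [z]. *)
pose I := (D * (nat * (nat * seq (D * rat))))%type.
pose w (i : I) := ind (b (val i.1, i.2.1) i.2.2.1 `&` cylinder i.2.2.2).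
pose V := closure (linear_span (range w)).
have Vlin : linear_subspace V.
  by apply: closure_subspace; exact: linear_span_subspace.
have Vclosed : closure V `<=` V by move=> z; exact: closure_id_norm.
(* Traces of all of [<<s G>>]: cylinders are closed under intersection. *)
have Vtrace z n i F : D z -> <<s G>> F -> V (ind (b (z, n) i `&` F)).
  move=> Dz; have [fb _] := (bP (z, n)).1 i.
  have fbF F' : <<s G>> F' -> finite_measurable (b (z, n) i `&` F').
    by move=> GF'; apply: finite_measurableI => //; exact: GsubM.
  suff : <<s G>> `<=` [set F | <<s G>> F /\ V (ind (b (z, n) i `&` F))].
    by move=> sub GF; have /= [_] := sub F GF.
  apply: (lambda_system_subset GI) => //; last first.
    move=> F' GF'; split; first exact: sub_sigma_algebra.
    case: GF' => s _ <-; apply: subset_closure; apply: sub_linear_span.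
    by exists (SigSub (mem_set Dz), (n, (i, s))).
  split=> //.
  - split; first exact: (@measurableT _ (g_sigma_algebraType G)).
    apply: subset_closure; apply: sub_linear_span.
    by exists (SigSub (mem_set Dz), (n, (i, [::]))).
  - move=> A B BA [GA VA] [GB VB].
    have GAB : <<s G>> (A `\` B).
      exact: (@measurableD _ (g_sigma_algebraType G)).
    split=> //; have -> : ind (b (z, n) i `&` (A `\` B)) =
        ind (b (z, n) i `&` A) - ind (b (z, n) i `&` B).
      apply/esym/eqP; rewrite subr_eq -ind_setU; [|exact: fbF|exact: fbF|].
        by rewrite -setIUr setUC setDUK.
      by rewrite setIACA setIid [X in _ `&` X]setIC setDIK setI0.
    exact: (subspaceB Vlin).
  - move=> F' F'incr GVF'.
    have GUF : <<s G>> (\bigcup_n F' n).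
      apply: (@bigcupT_measurable _ (g_sigma_algebraType G)) => k.
      by case: (GVF' k).
    split=> //; rewrite setI_bigcupr.
    apply: (subspace_ind_bigcup Vclosed) => //.
    + move=> k l kl; apply/subsetPset; apply: setIS; apply/subsetPset.
      exact: F'incr.
    + by move=> k; case: (fbF (F' k) (proj1 (GVF' k))).
    + by rewrite -setI_bigcupr; exact: fbF.
    + by move=> k; case: (GVF' k).
(* All parts of a relative atom are such traces. *)
have Vatom z n i S : D z -> measurable S -> S `<=` b (z, n) i -> V (ind S).
  move=> Dz mS Sb; have [fb atb] := (bP (z, n)).1 i.
  have [F [GF SF bFS]] := atb S mS Sb.
  have fS : finite_measurable S.
    by rewrite -(setIidr Sb); exact: finite_measurableI.
  rewrite (@eq_ind _ _ _ mu p p1 S (b (z, n) i `&` F))//; first exact: Vtrace.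
    by apply: finite_measurableI => //; exact: GsubM.
  apply: negligibleS SF => x [Sx nbF]; split=> // Fx; apply: nbF.
  by split=> //; exact: Sb.
have [z0 Dz0] : D !=set0 by exact: infinite_setN0.
(* A set of finite measure is an increasing union of finite disjoint unions of
   parts of relative atoms. *)
have Vind S : finite_measurable S -> V (ind S).
  move=> fS; have [mS muS] := fS.
  have [||C [CP Cmax]] := @exhaustion _ _ _ mu S
      [set B | exists z n i, D z /\ B = b (z, n) i] fS.
  - by move=> _ [z [n [i [_ ->]]]]; have [[]] := (bP (z, n)).1 i.
  - by exists (b (z0, 0%N) 0%N); exists z0, 0%N, 0%N.
  have mC k : measurable (C k).
    by have [z [n [i [_ ->]]]] := CP k; have [[]] := (bP (z, n)).1 i.
  pose U k := S `&` \big[setU/set0]_(j < k) C j.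
  have mU k : measurable (U k).
    by apply: measurableI => //; exact: bigsetU_measurable.
  have fU k : finite_measurable (U k).
    by apply: finite_measurableI => //; exact: bigsetU_measurable.
  have UE : \bigcup_k U k = S `&` \bigcup_k C k.
    rewrite /U -setI_bigcupr; congr (_ `&` _); apply/seteqP; split=> x.
      move=> [k _]; rewrite -bigcup_mkord => -[j _ Cx]; by exists j.
    by move=> [k _ Cx]; exists k.+1 => //; rewrite big_ord_recr; right.
  have fSC : finite_measurable (S `&` \bigcup_k C k).
    by apply: finite_measurableI => //; exact: bigcupT_measurable.
  have VU k : V (ind (U k)).
    elim: k => [|k IH].
      rewrite /U big_ord0 setI0 ind0 ?measure0//.
        by have /linear_subspaceP[] := Vlin.
      by split=> //; rewrite measure0.
    have -> : U k.+1 = U k `|` (S `&` C k `\` \big[setU/set0]_(j < k) C j).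
      rewrite /U big_ord_recr/= setIUr; apply/seteqP; split=> x.
        move=> [|[Sx Cx]]; first by left.
        by have [Ux|nUx] := pselect ((\big[setU/set0]_(j < k) C j) x);
          [left|right].
      by move=> [|[[Sx Cx] _]]; [left|right].
    have mE : measurable (S `&` C k `\` \big[setU/set0]_(j < k) C j).
      apply: measurableD; [exact: measurableI|exact: bigsetU_measurable].
    rewrite ind_setU//.
    - apply: (subspaceD Vlin) => //; have [z [n [i [Dz Cb]]]] := CP k.
      by apply: (Vatom z n i) => // x [[_ +] _]; rewrite Cb.
    - split=> //; apply: le_lt_trans muS; rewrite le_measure ?inE//.
      by move=> x [[]].
    - by apply/seteqP; split=> // x [[_ Ux] [_ nUx]].
  rewrite (@eq_ind _ _ _ mu p p1 S (S `&` \bigcup_k C k))//; last first.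
  - by apply: negligibleS (negligible_set0 mu) => x [[Sx _]].
  - rewrite setDIr setDv set0U.
    apply: contrapT => nn.
    have nnSC : nonnull (S `\` \bigcup_k C k).
      rewrite setDE; apply: nonnullI; rewrite -?setDE//.
      by apply: measurableC; exact: bigcupT_measurable.
    have [z [n [Dz nlev]]] := has_level _ nnSC; apply: nlev.
    have [_ cov] := bP (z, n).
    have neg i : mu.-negligible ((S `&` b (z, n) i) `\` \bigcup_k C k).
      by apply: Cmax; exists z, n, i.
    apply: negligibleS (negligibleU cov (negligible_bigcup neg)).
    move=> x [[Sx nCx] lx].
    have [[i _ bx]|nbx] := pselect ((\bigcup_i b (z, n) i) x); last by left.
    by right; exists i.
  - rewrite -UE; apply: (subspace_ind_bigcup Vclosed) => //.
      move=> k l kl; apply/subsetPset => x [Sx Ux]; split=> //.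
      move: Ux; rewrite -!bigcup_mkord => -[j /= jk Cx].
      by exists j => //=; exact: leq_trans jk kl.
    by rewrite UE.
have dense : densely_spans [set: L] (range w).
  by split=> // z _; exact: (subspace_ind_full Vlin Vclosed Vind).
move/negP: densD; apply; apply: (card_le_trans ((densP _).2 _ dense)).
apply: (card_le_trans (card_image_le _ _)).
rewrite -(card_le_eqr (card_setT D)).
have TDinf : infinite_set [set: D].
  apply: contra_not Dinf => -[n Dn]; exists n.
  by rewrite -(card_eql (card_setT D)).
have [g ginj] := infinite_nat_inj TDinf.
have [f finj] := infinite_pairing TDinf.
have [h hinj] := infinite_seq_inj TDinf.
pose code (i : I) := f (i.1, f (g i.2.1, f (g i.2.2.1,
  h [seq f (zq.1, g (choice.pickle zq.2)) | zq <- i.2.2.2]))).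
have code_inj : injective code.
  move=> [z [n [i s]]] [z' [n' [i' s']]].
  move=> /finj[-> /finj[/ginj -> /finj[/ginj -> /hinj]]].
  move=> ss'; congr (_, (_, (_, _))); apply: inj_map ss'.
  by move=> [y q] [y' q'] /finj[-> /ginj /(pcan_inj choice.pickleK) ->].
have : (range code #= [set: I])%card.
  by apply: inj_card_eq => i j _ _; exact: code_inj.
rewrite card_eq_le => /andP[_ codeI].
exact: card_le_trans codeI (card_leT _).
Qed.

End infinite_density.

Theorem proposition6p11 (R : realType) (d : measure_display)
    (M : measurableType d) (mu : {measure set M -> \bar R})
    (p : R) (p1 : (1 <= p%:E)%E)
    (Linf : infinite_dimensional (LspaceType mu p1)) :
  octahedral (dens [set: LspaceType mu p1]) (phi p) (LspaceType mu p1).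
Proof.
move=> eps Z eps0 _ /andP[_ densZ].
apply: small_restr_octahedral => // eta eta0.
have [Zfin|Zinf] := pselect (finite_set (dens Z)).
  exact: finite_dens_small.
apply: (infinite_density_small Zinf) => //.
by have [[_ Zd] _] := densP Z.
Qed.
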